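(* Let $N$ be a countable binary-conflict-free net. Then $N$ has exactly one maximal BD-process.
   Context: **Multisets.** A multiset over $X$ is a function $A:X\to\mathbb N$; $x\in A$ iff $A(x)>0$; $A\subseteq B$ iff $A(x)\le B(x)$ for all $x$; $(A\cap B)(x)=\min(A(x),B(x))$; $(A+B)(x)=A(x)+B(x)$; $(A-B)(x)=\max(A(x)-B(x),0)$; $(k\cdot A)(x)=k\,A(x)$; $|A|=\sum_{x}A(x)$; $A$ is finite iff $|A|<\infty$; $A\restriction Y$ is the restriction to $Y\subseteq X$. Multisets on different domains are identified if they agree after extension by $0$. A set is identified with the corresponding $0/1$-valued multiset, and $\{t,u\}$ denotes a multiset (so $\{t,t\}$ has cardinality $2$). **Nets.** A net is $N=(S,T,F,M_0)$ with $S,T$ disjoint sets (places, transitions), $F:(S\times T)\cup(T\times S)\to\mathbb N$ (flow relation with arc weights) and $M_0:S\to\mathbb N$ (initial marking), such that for each $t\in T$ the set $\{s\mid F(s,t)>0\}$ is finite and non-empty and $\{s\mid F(t,s)>0\}$ is finite. $N$ is countable iff $S$ and $T$ are countable. For $x\in S\cup T$, ${}^\bullet x(y)=F(y,x)$ and $x^\bullet(y)=F(x,y)$ (multisets), extended additively to multisets $X$: ${}^\bullet X=\sum_x X(x)\cdot{}^\bullet x$, $X^\bullet=\sum_x X(x)\cdot x^\bullet$. Markings are elements of $\mathbb N^S$. **Firing.** For a finite non-empty $G\in\mathbb N^T$, $M\xrightarrow{G}M'$ iff ${}^\bullet G\subseteq M$ and $M'=(M-{}^\bullet G)+G^\bullet$.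 For $\sigma=t_1\cdots t_n\in T^*$, $M\xrightarrow{\sigma}M'$ means $M\xrightarrow{\{t_1\}}M_1\cdots\xrightarrow{\{t_n\}}M'$ for some intermediate markings. Omitted $\sigma$ or $M'$ are existentially quantified; $M$ is reachable iff $M_0\xrightarrow{\sigma}M$ for some $\sigma\in T^*$. **Conflict.** A finite non-empty multiset $G\in\mathbb N^T$ is in (semantic) conflict in $M$ iff $M\xrightarrow{G\restriction\{t\}}$ for all $t\in G$ but not $M\xrightarrow{G}$. $N$ is binary-conflict-free iff no multiset $G\in\mathbb N^T$ with $|G|=2$ is in conflict in any reachable marking. **Processes.** A (GR-)process of $N$ is $P=(\mathcal N,\pi)$ where $\mathcal N=(\mathcal S,\mathcal T,\mathcal F,\mathcal M_0)$ is a net such that: every $s\in\mathcal S$ has $|{}^\bullet s|\le1$, $|s^\bullet|\le 1$, and $\mathcal M_0(s)=1$ if ${}^\bullet s=\emptyset$, $\mathcal M_0(s)=0$ otherwise; $\mathcal F$ is acyclic, i.e. $(x,x)\notin\mathcal F^+$ for all $x$, where $\mathcal F^+$ is the transitive closure of $\{(x,y)\mid\mathcal F(x,y)>0\}$; $\{t\mid (t,u)\in\mathcal F^+\}$ is finite for all $u\in\mathcal T$; and $\pi:\mathcal S\cup\mathcal T\to S\cup T$ satisfies $\pi(\mathcal S)\subseteq S$, $\pi(\mathcal T)\subseteq T$, $M_0(s)=|\pi^{-1}(s)\cap\mathcal M_0|$ for all $s\in S$, and for all $t\in\mathcal T,s\in S$: $F(s,\pi(t))=|\pi^{-1}(s)\cap{}^\bullet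 t|$ and $F(\pi(t),s)=|\pi^{-1}(s)\cap t^\bullet|$. $P$ is finite iff $\mathcal T$ is finite. For processes $P=((\mathcal S,\mathcal T,\mathcal F,\mathcal M_0),\pi)$, $P'=((\mathcal S',\mathcal T',\mathcal F',\mathcal M_0'),\pi')$ of the same net, $P'\le P$ ($P'$ is a prefix of $P$) iff $\mathcal S'\subseteq\mathcal S$, $\mathcal T'\subseteq\mathcal T$, $\mathcal M_0'=\mathcal M_0$, and $\mathcal F',\pi'$ are the restrictions of $\mathcal F,\pi$ to the elements of $\mathcal S'\cup\mathcal T'$. Processes $(\mathcal N,\pi)$, $(\mathcal N',\pi')$ are isomorphic iff there is a net isomorphism $\phi:\mathcal N\to\mathcal N'$ (bijection on places and on transitions preserving flow and initial marking) with $\pi=\pi'\circ\phi$. **Swapping.** For $p,q\in\mathcal S$ with $(p,q)\notin\mathcal F^+\cup(\mathcal F^+)^{-1}$ and $\pi(p)=\pi(q)$, $\mathrm{swap}(P,p,q)$ is $((\mathcal S,\mathcal T,\mathcal F',\mathcal M_0),\pi)$ with, for $y\in\mathcal T$, $\mathcal F'(p,y)=\mathcal F(q,y)$, $\mathcal F'(q,y)=\mathcal F(p,y)$, and $\mathcal F'=\mathcal F$ otherwise. $P\approx_s Q$ iff $\mathrm{swap}(P,p,q)$ is isomorphic to $Q$ for some such $p,q$; $\approx_s^*$ is the reflexive transitive closure. For finite $P$, $[P]_s$ is its $\approx_s^*$-class, and $[P']_s\le[P]_s$ iff $P'\approx_s^*Q'\le Q\approx_s^*P$ for some $Q',Q$.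 For any process $P$, $\mathrm{BD}(P):={\downarrow}\{[P']_s\mid P'\le P,\ P'\text{ finite}\}$, where $\downarrow$ is downward closure under $\le$ among classes of finite processes. $P\approx_s^\infty Q$ iff $\mathrm{BD}(P)=\mathrm{BD}(Q)$. A BD-process is an $\approx_s^\infty$-equivalence class $[P]_\infty$ of processes. $[P]_\infty$ is maximal iff for all $P'\in[P]_\infty$ and all processes $Q$: $P'\le Q$ implies $P'\approx_s^\infty Q$. *)

(* Defs.v *)
(* MathComp world, with the classical layer of MathComp-Analysis. *)
From Stdlib Require Import Relation_Operators.
From HB Require Import structures.
From mathcomp Require Import all_boot.
From mathcomp Require Import boolp classical_sets functions cardinality fsbigop.

Set Implicit Arguments.
Unset Strict Implicit.
Unset Printing Implicit Defensive.

Local Open Scope classical_set_scope.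

(** ** Multisets *)

Definition mset (X : Type) := X -> nat.

Section Multisets.
Variable X : Type.
Implicit Types (A B : mset X) (Y : set X).

Definition msupp A : set X := [set x | 0 < A x].
Definition msub A B : Prop := forall x, A x <= B x.
Definition mcap A B : mset X := fun x => minn (A x) (B x).
Definition madd A B : mset X := fun x => A x + B x.
Definition mdiff A B : mset X := fun x => A x - B x.
Definition mempty : mset X := fun=> 0.
Definition mset_of Y : mset X := fun x => (x \in Y : nat).
Definition mrestr A Y : mset X := fun x => if x \in Y then A x else 0.

(* As multiplicities are natural numbers, |A| is finite iff the support is. *)
Definition mfinite A : Prop := finite_set (msupp A).

(* The sum of A(x) * f(x) over all x.  [{classic X}] is X with its classical
   choiceType structure.  If [A] is infinite the value may be the junk value 0. *)
Definition msum A (f : X -> nat) : nat :=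
  \big[addn/0%N]_(x \in [set: {classic X}]) (A x * f x)%N.

(* |A| = n, with |A| finite *)
Definition mcard A (n : nat) : Prop := mfinite A /\ msum A (fun=> 1) = n.

Definition mcard_le A (n : nat) : Prop := exists2 k, k <= n & mcard A k.

End Multisets.

(** ** Nets *)

(* The data (S, T, F, M0) of a net.  Disjointness of S and T is built in, and F
   is given by its two halves: [arcST s t] is F(s,t), [arcTS t s] is F(t,s). *)
Record prenet := PreNet {
  place : Type;
  trans : Type;
  arcST : place -> trans -> nat;
  arcTS : trans -> place -> nat;
  init : mset place
}.

Section PreNet.
Variable N : prenet.
Implicit Types (s : place N) (t : trans N).

Definition preT t : mset (place N) := fun s => arcST s t.
Definition postT t : mset (place N) := fun s => arcTS t s.
Definition preS s : mset (trans N) := fun t => arcTS t s.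
Definition postS s : mset (trans N) := fun t => arcST s t.

Definition is_net : Prop := forall t,
  [/\ finite_set (msupp (preT t)), msupp (preT t) !=set0 &
      finite_set (msupp (postT t))].

Definition flow (x y : place N + trans N) : nat :=
  match x, y with
  | inl s, inr t => arcST s t
  | inr t, inl s => arcTS t s
  | _, _ => 0
  end.

Definition flow_plus : place N + trans N -> place N + trans N -> Prop :=
  clos_trans _ (fun x y => 0 < flow x y).

End PreNet.

Record net := Net { net_data :> prenet; net_axiom : is_net net_data }.

Definition countable_net (N : net) : Prop :=
  countable [set: place N] /\ countable [set: trans N].

(** ** Firing and conflict *)

Section Firing.
Variable N : net.

Definition marking := mset (place N).
Implicit Types (M : marking) (G : mset (trans N)).

(* Meaningful for finite [G]. *)
Definition preG G : marking := fun s => msum G (fun t => preT t s).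
Definition postG G : marking := fun s => msum G (fun t => postT t s).

Definition fires M G M' : Prop :=
  [/\ mfinite G, msupp G !=set0, msub (preG G) M &
      M' = madd (mdiff M (preG G)) (postG G)].

Definition enabled M G : Prop := exists M', fires M G M'.

Fixpoint fires_seq M (sigma : seq (trans N)) M' : Prop :=
  match sigma with
  | [::] => M = M'
  | t :: sigma' =>
      exists2 M1, fires M (mset_of [set t]) M1 & fires_seq M1 sigma' M'
  end.

Definition reachable M : Prop := exists sigma, fires_seq (@init N) sigma M.

Definition in_conflict G M : Prop :=
  [/\ mfinite G, msupp G !=set0,
      forall t, msupp G t -> enabled M (mrestr G [set t]) &
      ~ enabled M G].

Definition binary_conflict_free : Prop :=
  forall G, mcard G 2 -> forall M, reachable M -> ~ in_conflict G M.

End Firing.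

(** ** Processes *)

Record preprocess (N : net) := PreProcess {
  pnet : prenet;
  piS : place pnet -> place N;
  piT : trans pnet -> trans N
}.

Section IsProcess.
Variables (N : net) (P : preprocess N).
Notation K := (pnet P).

Definition is_process : Prop :=
  is_net K /\
  (forall s : place K,
    [/\ mcard_le (preS s) 1, mcard_le (postS s) 1,
        preS s = @mempty _ -> init s = 1 &
        preS s <> @mempty _ -> init s = 0]) /\
  (forall x : place K + trans K, ~ flow_plus x x) /\
  (forall u : trans K,
    finite_set [set t : trans K | flow_plus (inr t) (inr u)]) /\
  (forall s : place N,
    mcard (mcap (mset_of (@piS N P @^-1` [set s])) (@init K)) (init s)) /\
  (forall (t : trans K) (s : place N),
    mcard (mcap (mset_of (@piS N P @^-1` [set s])) (preT t))
          (arcST s (piT t)) /\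
    mcard (mcap (mset_of (@piS N P @^-1` [set s])) (postT t))
          (arcTS (piT t) s)).

End IsProcess.

Record process (N : net) := Process {
  process_data :> preprocess N;
  process_axiom : is_process process_data
}.

Section Processes.
Variable N : net.
Implicit Types P Q R : process N.

Definition pfinite P : Prop := finite_set [set: trans (pnet P)].

(* Types have no inclusion relation, so the inclusions of places and transitions
   are given by injections [f] and [g].  The two conditions on [init] say that
   both initial markings agree once the smaller one is extended by 0. *)
Definition prefix_of P' P : Prop :=
  exists (f : place (pnet P') -> place (pnet P))
         (g : trans (pnet P') -> trans (pnet P)),
    [/\ injective f, injective g,
        (forall s, init (f s) = init s) /\ (forall s, ~ range f s -> init s = 0),
        forall s t, arcST (f s) (g t) = arcST s t /\
                    arcTS (g t) (f s) = arcTS t s &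
        (forall s, piS (f s) = piS s) /\ (forall t, piT (g t) = piT t)].

Definition isomorphic (P Q : preprocess N) : Prop :=
  exists (f : place (pnet P) -> place (pnet Q))
         (g : trans (pnet P) -> trans (pnet Q)),
    [/\ bijective f, bijective g, forall s, init (f s) = init s,
        forall s t, arcST (f s) (g t) = arcST s t /\
                    arcTS (g t) (f s) = arcTS t s &
        (forall s, piS (f s) = piS s) /\ (forall t, piT (g t) = piT t)].

Definition swap (P : preprocess N) (p q : place (pnet P)) : preprocess N :=
  @PreProcess N
    (@PreNet (place (pnet P)) (trans (pnet P))
       (fun s t => arcST (if `[< s = p >] then q else if `[< s = q >] then p else s) t)
       (@arcTS (pnet P)) (@init (pnet P)))
    (@piS N P) (@piT N P).

Definition swap_step P Q : Prop :=
  exists p q : place (pnet P),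
    [/\ ~ flow_plus (inl p) (inl q), ~ flow_plus (inl q) (inl p),
        piS p = piS q & isomorphic (swap p q) Q].

Definition swap_eq : process N -> process N -> Prop :=
  clos_refl_trans _ swap_step.

Definition swap_class P : set (process N) := [set Q | swap_eq Q P].

Definition finite_class (C : set (process N)) : Prop :=
  exists2 P, pfinite P & C = swap_class P.

Definition class_le (C' C : set (process N)) : Prop :=
  exists P' P, [/\ pfinite P', pfinite P, C' = swap_class P', C = swap_class P &
    exists Q' Q, [/\ swap_eq P' Q', prefix_of Q' Q & swap_eq Q P]].

Definition downset (X : set (set (process N))) : set (set (process N)) :=
  [set C | finite_class C /\ exists2 D, X D & class_le C D].

Definition BD P : set (set (process N)) :=
  downset [set C | exists P',
    [/\ prefix_of P' P, pfinite P' & C = swap_class P']].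

Definition swap_eq_inf P Q : Prop := BD P = BD Q.

Definition BD_class P : set (process N) := [set Q | swap_eq_inf P Q].

Definition BD_process (C : set (process N)) : Prop := exists P, C = BD_class P.

Definition BD_maximal (C : set (process N)) : Prop :=
  forall P' Q, C P' -> prefix_of P' Q -> swap_eq_inf P' Q.

End Processes.

(* Main.v *)
Require Import Defs.
From Stdlib Require Import Relation_Operators.
From HB Require Import structures.
From mathcomp Require Import all_boot zify.
From mathcomp Require Import boolp classical_sets functions cardinality fsbigop.

(* A firable sequence of transitions determines a process up to swapping: once it is fixed,
   only the choice of the tokens to consume is left, and exchanging tokens one at a time
   turns any choice into any other.  As every process of a countable net can be linearized
   (transitions have finite pasts), BD(P) depends only on a sequence, finite or infinite,
   and is not changed by exchanging adjacent concurrent transitions.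

   In a binary-conflict-free net an enabled transition stays enabled, concurrently to all
   others, until it fires.  Hence any two finite sequences have a common extension up to
   such exchanges, and an increasing chain dominating all of the countably many finite
   sequences yields a process whose BD contains every class of finite processes.
   Conversely let P be maximal and sigma firable.  Moving the transitions of sigma one by
   one to the front of a linearization of P leaves BD(P) unchanged.  This could only fail at
   a transition u that never fires in P; but then a process equivalent to P can be built that
   never touches the tokens needed by u, and adding u to it contradicts maximality. *)

Set Implicit Arguments.
Unset Strict Implicit.
Unset Printing Implicit Defensive.
Local Open Scope classical_set_scope.

(** Tokens are named by producer, place and number, so all runs of one sequence have the same places
    and transitions and differ only in the function giving the consumer of a token. Comparing
    processes up to swapping thus becomes comparing functions. Idle letters keep everything a total
    sequence: numbering the transitions of a process leaves gaps, deleting a causally closed part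
    leaves holes, and a finite word is padded on the right. The main obstacle is that the order on
    classes interleaves swaps with prefixes. To normalize it, a swap must be carried from a prefix
    to a larger process, and the result must again be a process. Both points are settled by a linear
    order in which the two places coexist at one moment: exchanging their consumers is then visibly
    harmless and reversible. To show that a class is absent from a BD set an invariant is needed;
    occurrences of a single transition are counted, since neither swaps nor passing to a prefix can
    increase their number. *)

(** * Cardinalities of multisets through duplicate-free lists *)

Lemma msum_seq (X : Type) (A : mset X) (f : X -> nat) (l : seq {classic X}) :
  uniq l -> (forall x, 0 < A x -> (x : {classic X}) \in l) ->
  msum A f = \sum_(x <- l) A x * f x.
Proof.
move=> lU Al; rewrite /msum (fsbigE l) //=; last first.
  move=> x _ xl; case: (posnP (A x)) => [-> // | /Al]; by rewrite (negbTE xl).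
by apply: eq_bigl => x; rewrite in_setT.
Qed.

Lemma finite_set_classic_seq (X : Type) (A : set X) :
  finite_set A -> exists2 l : seq {classic X}, uniq l & forall x : {classic X}, (x \in l) <-> A x.
Proof.
move=> Afin; have [l Al] := (@finite_seqP {classic X} A).1 Afin.
exists (undup l); first exact: undup_uniq.
by move=> x; rewrite mem_undup Al.
Qed.

Lemma mcard_seq (X : Type) (A : mset X) n :
  (forall x, A x <= 1) ->
  mcard A n <-> exists l : seq {classic X},
    [/\ uniq l, size l = n & forall x : {classic X}, (x \in l) = (0 < A x)].
Proof.
move=> A1.
have sumE (l : seq {classic X}) : uniq l -> (forall x : {classic X}, (x \in l) = (0 < A x)) ->
    msum A (fun=> 1) = size l.
  move=> lU lA; rewrite (@msum_seq X A _ l) //; last by move=> x; rewrite lA.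
  rewrite -sum1_size; apply: eq_big_seq => x; rewrite lA muln1 => Ax.
  by apply/eqP; rewrite eqn_leq A1.
split=> [[Afin <-] | [l [lU <- lA]]].
  have [l lU lA] := finite_set_classic_seq Afin.
  have lA' (x : {classic X}) : (x \in l) = (0 < A x) by apply/idP/idP => /lA.
  by exists l; rewrite (sumE l).
split; last exact: sumE.
apply/(@finite_seqP {classic X}); exists l; apply/seteqP.
by split=> x /=; rewrite lA.
Qed.

(** Intersecting with a set caps all multiplicities at 1, so the labelling conditions of a process
    amount to enumerating a fiber without repetition. *)
Lemma mcard_fiber (X Y : Type) (h : X -> Y) (s : Y) (A : mset X) n :
  mcard (mcap (mset_of (h @^-1` [set s])) A) n <->
  exists l : seq {classic X},
    [/\ uniq l, size l = n & forall x : {classic X}, (x \in l) <-> h x = s /\ 0 < A x].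
Proof.
have capE x : (0 < mcap (mset_of (h @^-1` [set s])) A x) <-> h x = s /\ 0 < A x.
  rewrite /mcap /mset_of leq_min.
  case: (boolP (x \in _)) => /=; rewrite ?inE ?notin_setE /=.
    by move=> ->; split => [|[]].
  by move=> hx; split=> // -[].
rewrite mcard_seq; last by move=> x; rewrite geq_min /mset_of leq_b1.
split=> -[l [lU ls lA]]; exists l; split=> // x.
  by rewrite lA.
by apply/idP/idP; [move/lA/capE | move/capE/lA].
Qed.

Lemma mcard_le1P (X : Type) (A : mset X) :
  mcard_le A 1 <-> (forall x, A x <= 1) /\ (forall x y, 0 < A x -> 0 < A y -> x = y).
Proof.
split=> [[k k1 [Afin Ak]] | [A1 Au]].
  have [l lU lA] := finite_set_classic_seq Afin.
  have Al x : 0 < A x -> (x : {classic X}) \in l by move/lA.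
  move: k1; rewrite -Ak (msum_seq (fun=> 1) lU Al).
  have Al0 x : (x : {classic X}) \notin l -> A x = 0.
    by case: (posnP (A x)) => // /Al ->.
  have lA0 (x : {classic X}) : x \in l -> 0 < A x by move/lA.
  case: l lU lA0 {lA} Al Al0 => [|a [|b l]] /= _ lA0 Al Al0.
  - by move=> _; split=> [x | x y /Al //]; rewrite Al0.
  - rewrite big_seq1 muln1 => Aa; split=> [x | x y Ax Ay].
      case: (eqVneq (x : {classic X}) a) => [-> // | xa].
      by rewrite Al0 // inE (negbTE xa).
    by have := Al x Ax; have := Al y Ay; rewrite !mem_seq1 => /eqP -> /eqP ->.
  - rewrite !big_cons !muln1.
    have := lA0 a (mem_head _ _); have : 0 < A b by apply: lA0; rewrite !inE eqxx orbT.
    by lia.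
case: (EM (exists x, 0 < A x)) => [[x Ax] | A0].
  exists 1 => //; apply/mcard_seq => //; exists [:: (x : {classic X})]; split=> // y.
  rewrite inE; apply/eqP/idP => [-> // | Ay]; exact: Au.
exists 0 => //; apply/mcard_seq => //; exists [::]; split=> // y.
by rewrite in_nil; apply/esym/negP => Ay; apply: A0; exists y.
Qed.

Lemma mem_classic (T : eqType) (l : seq T) (x : T) :
  ((x : {classic T}) \in (l : seq {classic T})) = (x \in l).
Proof.
elim: l => // a l IH; have := @in_cons {classic T} a l x; rewrite IH => ->.
by rewrite in_cons; congr (_ || _); apply/eqP/eqP.
Qed.

Lemma uniq_classic (T : eqType) (l : seq T) : uniq (l : seq {classic T}) = uniq l.
Proof. by elim: l => //= a l ->; rewrite mem_classic. Qed.

Lemma mcard_fiber_seq (X : eqType) (Y : Type) (h : X -> Y) (s : Y) (A : mset X) (l : seq X) :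
  uniq l -> (forall x, (x \in l) <-> h x = s /\ 0 < A x) ->
  mcard (mcap (mset_of (h @^-1` [set s])) A) (size l).
Proof.
move=> lU lA; apply/mcard_fiber; exists l; split=> //; first by rewrite uniq_classic.
by move=> x; rewrite mem_classic.
Qed.

Lemma finite_set_seq (X : eqType) (A : set X) (l : seq X) :
  (forall x, A x -> x \in l) -> finite_set A.
Proof.
move=> Al; apply: (@sub_finite_set _ _ [set` l]); first by move=> x /Al.
exact: finite_seq.
Qed.

(** * Runs: sequences of letters with a choice of consumed tokens *)

Lemma eq_count_mem (T : eqType) (p q : pred T) (l1 l2 : seq T) :
  uniq l1 -> uniq l2 ->
  (forall x, (x \in l1) && p x = (x \in l2) && q x) -> count p l1 = count q l2.
Proof.
move=> l1U l2U E; rewrite -!size_filter; apply: perm_size.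
apply: uniq_perm; rewrite ?filter_uniq // => x.
by rewrite !mem_filter andbC E andbC.
Qed.

(* Places with decidable equality.  The alias [{classic place N}] cannot be used here: the
   processes built from tokens would land in too large a universe. *)
Definition eq_place (N : net) : Type := place N.
HB.instance Definition _ (N : net) := gen_eqMixin (eq_place N).

Section Runs.
Variable N : net.

(* The letter [None] is an idle step.  The token [(o, s, i)] is the [i]-th one put on the
   place [s] by the letter of index [k] if [o = Some k], initially if [o = None]. *)
Notation letter := (option (trans N)).
Notation token := (option nat * eq_place N * nat)%type.
Implicit Types (L : nat -> letter) (M : marking N) (c : token -> option nat).

Definition pre (a : letter) (s : place N) := if a is Some t then preT t s else 0.
Definition post (a : letter) (s : place N) := if a is Some t then postT t s else 0.

Definition step M a : marking N := fun s => M s - pre a s + post a s.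

Fixpoint mark L n : marking N :=
  if n is n'.+1 then step (mark L n') (L n') else @init N.

Definition firable L := forall j s, pre (L j) s <= mark L j s.

Definition producer (x : token) := x.1.1.
Definition label (x : token) : eq_place N := x.1.2.

Definition batch (o : option nat) n (s : eq_place N) : seq token :=
  [seq (o, s, i) | i <- iota 0 n].

(** Consumed tokens are kept in this list: it depends on [L] only, not on the choice of
    consumers. *)
Fixpoint tokens L n (s : eq_place N) :=
  if n is n'.+1 then tokens L n' s ++ batch (Some n') (post (L n') s) s
  else batch None (@init N s) s.

Definition created L o (s : eq_place N) := if o is Some k then post (L k) s else @init N s.
Definition before (o : option nat) j := if o is Some k then k < j else true.

Definition valid L (x : token) := x.2 < created L (producer x) (label x).

Lemma mem_batch o n s (x : token) :
  (x \in batch o n s) = [&& producer x == o, label x == s & x.2 < n].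
Proof.
apply/mapP/and3P => [[i + ->] | [/eqP <- /eqP <- xn]].
  by rewrite mem_iota.
by exists x.2; rewrite ?mem_iota //; case: x {xn} => [[]].
Qed.

Lemma mem_tokens L n s (x : token) :
  (x \in tokens L n s) = [&& label x == s, before (producer x) n & valid L x].
Proof.
case: x => [[o s'] i]; rewrite /valid /label /producer /=.
elim: n => [|n IH]; rewrite /= ?mem_cat ?IH mem_batch /label /producer /=;
  case: (eqVneq s' s) => [-> /=|_]; rewrite ?andbF //; clear; case: o => [k|] //=.
  rewrite (inj_eq Some_inj) ltnS; case: (ltngtP k n) => [|| ->]; by rewrite ?orbF.
by rewrite orbF.
Qed.

Lemma tokens_uniq L n s : uniq (tokens L n s).
Proof.
have batchU o m : uniq (batch o m s) by rewrite map_inj_uniq ?iota_uniq // => i j [].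
elim: n => [|n IH] //=; rewrite cat_uniq IH batchU andbT.
apply/hasPn => x; rewrite mem_batch mem_tokens => /and3P[/eqP -> _ _].
by rewrite /= ltnn andbF.
Qed.

(** The first clause is causality (a token exists before it is consumed) and holds at every index;
    only the clause on the number of consumed tokens is limited to the first [n] steps. *)
Definition partial_run L c n :=
  (forall x j, c x = Some j -> x \in tokens L j (label x)) /\
  (forall j s, j < n -> count (fun x => c x == Some j) (tokens L j s) = pre (L j) s).

(* [c x] is the index of the consumer of the token [x]. *)
Definition is_run L c :=
  (forall x j, c x = Some j -> x \in tokens L j (label x)) /\
  (forall j s, count (fun x => c x == Some j) (tokens L j s) = pre (L j) s).

Lemma is_run_partial L c n : is_run L c -> partial_run L c n.
Proof. by case=> H1 H2; split. Qed.

Lemma is_run_mem L c x j : is_run L c -> c x = Some j ->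
  before (producer x) j /\ valid L x.
Proof. by move=> [H _] /H; rewrite mem_tokens => /and3P[]. Qed.

Lemma is_run_None L c x j : is_run L c -> L j = None -> c x != Some j.
Proof.
move=> [H1 H2] Lj; apply/negP => /eqP cx.
have := H2 j (label x); rewrite Lj /= => /eqP; rewrite -leqn0 leqNgt -has_count.
by move/hasPn => /(_ x (H1 _ _ cx)); rewrite cx eqxx.
Qed.

Definition unconsumed c n (x : token) := if c x is Some i then n <= i else true.

(** Step [k] removes from the live tokens exactly those with consumer [k], which are [pre (L k) s]
    many, and the batch it adds is entirely live because consumption comes strictly after
    production. *)
Lemma partial_run_mark L c n : partial_run L c n ->
  forall j s, j <= n -> mark L j s = count (unconsumed c j) (tokens L j s) /\
    (j < n -> pre (L j) s <= mark L j s).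
Proof.
move=> [H1 H2] j s.
have consume k : k < n -> mark L k s = count (unconsumed c k) (tokens L k s) ->
    mark L k s = count (unconsumed c k.+1) (tokens L k s) + pre (L k) s.
  move=> kn ->; rewrite -(H2 k s kn) !(count_predT, =^~ size_filter).
  rewrite -(count_predC (fun x => c x == Some k)) !size_filter addnC !count_filter.
  congr (_ + _); apply: eq_count => x /=; rewrite /unconsumed;
    case: (c x) => [i|] //=; rewrite (inj_eq Some_inj);
    by case: ltngtP => // ->; rewrite eqxx.
elim: j => [|j IH] jn.
  have E : mark L 0 s = count (unconsumed c 0) (tokens L 0 s).
    rewrite /= (@eq_count _ _ predT) ?count_predT ?size_map ?size_iota //.
    by move=> x; rewrite /unconsumed; case: (c x).
  by split=> // n0; rewrite (consume 0 n0 E) leq_addl.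
have [E _] := IH (ltnW jn).
have E' : mark L j.+1 s = count (unconsumed c j.+1) (tokens L j.+1 s).
  rewrite /= /step (consume j jn E) addnK count_cat; congr (_ + _).
  rewrite (@eq_in_count _ _ predT) ?count_predT ?size_map ?size_iota //.
  move=> x; rewrite mem_batch => /and3P[/eqP px _ _]; rewrite /unconsumed.
  case cx: (c x) => [i|] //; have := H1 _ _ cx; rewrite mem_tokens px /=.
  by case/and3P.
by split=> // jn1; rewrite (consume j.+1 jn1 E') leq_addl.
Qed.

Lemma run_firable L c : is_run L c -> firable L.
Proof.
by move=> H j s; have [_] := partial_run_mark (is_run_partial j.+1 H) s (leqnSn j); apply.
Qed.

(** * Greedy choice of consumed tokens under a restriction *)

Section Greedy.
Variables (L : nat -> letter) (allowed : nat -> pred token).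

Definition available n c x := (c x == None) && allowed n x.

Definition greedy_step n c : token -> option nat := fun x =>
  if c x is Some i then Some i
  else if x \in take (pre (L n) (label x))
                  (filter (available n c) (tokens L n (label x))) then Some n
  else None.

Fixpoint greedy n := if n is n'.+1 then greedy_step n' (greedy n') else fun=> None.

Definition greedy_inv n c :=
  partial_run L c n /\ forall x i, c x = Some i -> (i < n) && allowed i x.

Hypothesis enough : forall n c, greedy_inv n c ->
  forall s, pre (L n) s <= count (available n c) (tokens L n s).

Lemma greedy_invP n : greedy_inv n (greedy n).
Proof.
elim: n => [|n IH]; first by split=> //; split.
have E := enough IH; case: IH => -[H1 H2] H3.
have stepS x i : greedy n.+1 x = Some i -> greedy n x = Some i \/
   [/\ i = n, greedy n x = None, allowed n x & x \in tokens L n (label x)].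
  rewrite /= /greedy_step; case g: (greedy n x) => [k|] ; first by left.
  case: ifP => // /mem_take; rewrite mem_filter => /andP[/andP[_ a] xt] [<-].
  by right.
split; first split.
- by move=> x i /stepS [/H1 //| [-> //]].
- move=> j s; rewrite ltnS leq_eqVlt => /orP[/eqP -> | jn]; last first.
    rewrite -(H2 j s jn); apply: eq_count => x /=.
    rewrite /greedy_step; case: (greedy n x) => // .
    by case: ifP => // _; rewrite (inj_eq Some_inj) gtn_eqF.
  rewrite -[RHS](size_takel (s := filter (available n (greedy n)) (tokens L n s)));
    last by rewrite size_filter.
  rewrite -size_filter; apply: perm_size; apply: uniq_perm.
  + by rewrite filter_uniq ?tokens_uniq.
  + by rewrite take_uniq ?filter_uniq ?tokens_uniq.
  move=> x; rewrite mem_filter; apply/andP/idP.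
    move=> [/eqP gx xt]; have xs : label x = s.
      by move: xt; rewrite mem_tokens => /andP[/eqP].
    move: gx; rewrite /= /greedy_step xs.
    case g: (greedy n x) => [k|]; last by case: ifP.
    by move=> [kn]; have := H3 _ _ g; rewrite kn ltnn.
  move=> xt; have := mem_take xt; rewrite mem_filter => /andP[/andP[/eqP g _] xt'].
  have xs : label x = s by move: xt'; rewrite mem_tokens => /andP[/eqP].
  by rewrite /= /greedy_step g xs xt.
- move=> x i /stepS [/H3/andP[/ltnW ? ->] | [-> _ -> _]]; last by rewrite ltnSn.
  by rewrite andbT.
Qed.

Lemma greedy_run : exists c, is_run L c /\ forall x i, c x = Some i -> allowed i x.
Proof.
have stable n m x i : n <= m -> greedy n x = Some i -> greedy m x = Some i.
  by move=> /subnK <- g; elim: (m - n) => //= k IH; rewrite /greedy_step IH.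
have at_index n x i : greedy n x = Some i -> greedy i.+1 x = Some i.
  elim: n => //= n IH; rewrite {1}/greedy_step; case g: (greedy n x) => [k|].
    by move=> ki; apply: IH; rewrite g.
  case: ifP => // xt [<-].
  by rewrite /= /greedy_step g xt.
(* The run is the limit of the stages: an assigned consumer never changes, and consumer [i] is
   assigned at stage [i.+1]. *)
have /boolp.choice[c cE] : forall x, exists o, forall i,
    o = Some i <-> exists n, greedy n x = Some i.
  move=> x; case: (EM (exists n i, greedy n x = Some i)) => [[n [i g]] | H].
    exists (Some i) => j; split=> [[<-] | [m g']]; first by exists n.
    by rewrite -(stable _ _ _ _ (leq_maxl n m) g) (stable _ _ _ _ (leq_maxr n m) g').
  by exists None => i; split=> // -[n g]; case: H; exists n, i.
exists c; split; first split.
- by move=> x j /cE[n g]; apply: (greedy_invP n).1.1.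
- move=> j s; rewrite -((greedy_invP j.+1).1.2 j s (ltnSn j)).
  apply: eq_count => x; apply/eqP/eqP => [/cE[n /at_index] // | g].
  by apply/cE; exists j.+1.
- by move=> x i /cE[n] /(greedy_invP n).2 /andP[].
Qed.

End Greedy.

Lemma partial_run_available L c n : partial_run L c n ->
  (forall x i, c x = Some i -> i < n) ->
  forall s, mark L n s = count (fun x => c x == None) (tokens L n s).
Proof.
move=> H cn s; have [-> _] := partial_run_mark H s (leqnn n).
apply: eq_count => x; rewrite /unconsumed; case cx: (c x) => [i|] //.
by rewrite leqNgt (cn _ _ cx).
Qed.

(** Letters of index in [W] can leave the tokens made by [k] untouched as soon as the marking has
    enough tokens besides these. This independence allows [k] to be moved past, or removed. *)
Lemma run_avoiding L k (W : pred nat) : firable L ->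
  (forall j s, k < j -> W j -> pre (L j) s + post (L k) s <= mark L j s) ->
  exists2 c, is_run L c &
    forall x j, c x = Some j -> W j -> producer x != Some k.
Proof.
move=> Lf Lk.
have [|c [cr ca]] := @greedy_run L (fun j x => W j ==> (producer x != Some k)).
  move=> n c [H1 H2] s.
  have cn x i : c x = Some i -> i < n by move=> /H2/andP[].
  have E := partial_run_available H1 cn s.
  case: (boolP ((k < n) && W n)) => [/andP[kn nm] | knm].
    (* At most [post (L k) s] live tokens are forbidden, and the hypothesis provides that many in
       excess. *)
    rewrite -(leq_add2r (post (L k) s)); apply: leq_trans (Lk n s kn nm) _.
    rewrite E -size_filter -(count_predC (fun x => producer x != Some k)) addnC.
    rewrite [X in _ <= X]addnC; apply: leq_add.
      rewrite count_filter.
      have -> : post (L k) s = size (batch (Some k) (post (L k) s) s).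
        by rewrite size_map size_iota.
      rewrite -size_filter; apply: uniq_leq_size; first by rewrite filter_uniq ?tokens_uniq.
      move=> x; rewrite mem_filter mem_tokens mem_batch /= negbK.
      move=> /andP[/andP[/eqP px _] /and3P[/eqP xs _]].
      by rewrite /valid px xs !eqxx.
    rewrite count_filter; apply: sub_count => x /= /andP[px cx].
    by rewrite /available cx px implybT.
  (* Here nothing is forbidden: either [n] is not in [W], or [n <= k] and [k] has produced nothing
     yet. *)
  apply: leq_trans (Lf n s) _; rewrite E; apply: eq_leq; apply: eq_in_count => x.
  rewrite mem_tokens => /and3P[_ px _]; rewrite /available.
  case: eqP => //= _; apply/esym/implyP => nm; move: knm; rewrite nm andbT.
  by apply: contraNneq => pk; move: px; rewrite pk.
by exists c => // x j cx jm; have := ca _ _ cx; rewrite jm.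
Qed.

Lemma run_exists L : firable L -> exists c, is_run L c.
Proof. by move=> Lf; have [//|c cr _] := @run_avoiding L 0 xpred0 Lf; exists c. Qed.

End Runs.

(** * Processes of runs *)

Lemma flow_plus_mono (K : prenet) (R : place K + trans K -> nat) :
  (forall x y, 0 < flow x y -> R x < R y) ->
  forall x y, flow_plus x y -> R x < R y.
Proof. by move=> H x y; elim=> [*|? ? ? _ xy _ yz]; [exact: H|exact: ltn_trans yz]. Qed.

Lemma flow_plus_map (K K' : prenet) (h : place K + trans K -> place K' + trans K') :
  (forall x y, 0 < flow x y -> 0 < flow (h x) (h y)) ->
  forall x y, flow_plus x y -> flow_plus (h x) (h y).
Proof.
move=> H x y; elim=> [a b ab|a b d _ ab _ bd]; first exact/t_step/H.
exact: t_trans ab bd.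
Qed.

(** * Isomorphisms and prefixes of preprocesses *)

Section Morphisms.
Variable N : net.
Implicit Types P Q R : preprocess N.

Definition is_iso P Q (f : place (pnet P) -> place (pnet Q))
    (g : trans (pnet P) -> trans (pnet Q)) :=
  [/\ bijective f, bijective g, forall s, init (f s) = init s,
      forall s t, arcST (f s) (g t) = arcST s t /\ arcTS (g t) (f s) = arcTS t s &
      (forall s, piS (f s) = piS s) /\ (forall t, piT (g t) = piT t)].

Definition is_prefix P Q (f : place (pnet P) -> place (pnet Q))
    (g : trans (pnet P) -> trans (pnet Q)) :=
  [/\ injective f, injective g,
      (forall s, init (f s) = init s) /\ (forall s, ~ range f s -> init s = 0),
      forall s t, arcST (f s) (g t) = arcST s t /\ arcTS (g t) (f s) = arcTS t s &
      (forall s, piS (f s) = piS s) /\ (forall t, piT (g t) = piT t)].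

(** Stated for preprocesses, because [swap] does not return a packaged process. *)
Definition preprefix P Q := exists f g, @is_prefix P Q f g.

Lemma is_iso_prefix P Q f g : @is_iso P Q f g -> is_prefix f g.
Proof.
case=> -[f' fK f'K] [g' gK g'K] fi fa fp; split=> //; try exact: can_inj.
by split=> // s []; exists (f' s).
Qed.

Lemma preprefix_iso P Q : isomorphic P Q -> preprefix P Q.
Proof. by case=> f [g fg]; exists f, g; apply: is_iso_prefix. Qed.

Lemma preprefix_trans P Q R : preprefix P Q -> preprefix Q R -> preprefix P R.
Proof.
move=> [f [g [fI gI [fi fn] fa [fp gp]]]] [f' [g' [fI' gI' [fi' fn'] fa' [fp' gp']]]].
exists (f' \o f), (g' \o g); split; try exact: inj_comp.
- split=> [s|s]; first by rewrite /= fi' fi.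
  move=> Hs; case: (EM (range f' s)) => [[u _ us] | /fn' //].
  rewrite -us fi'; apply: fn => -[v _ vu]; apply: Hs; exists v => //=.
  by rewrite vu.
- by move=> s t /=; case: (fa' (f s) (g t)) => -> ->; apply: fa.
- by split=> s /=; rewrite ?fp' ?gp' ?fp ?gp.
Qed.

Lemma is_iso_comp P Q R f g f' g' :
  @is_iso P Q f g -> @is_iso Q R f' g' -> is_iso (f' \o f) (g' \o g).
Proof.
move=> [fb gb fi fa [fp gp]] [fb' gb' fi' fa' [fp' gp']].
split; try exact: bij_comp.
- by move=> s /=; rewrite fi' fi.
- by move=> s t /=; case: (fa' (f s) (g t)) => -> ->; apply: fa.
- by split=> s /=; rewrite ?fp' ?gp' ?fp ?gp.
Qed.

Lemma is_iso_sym P Q f g : @is_iso P Q f g ->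
  exists f' g', [/\ cancel f f', cancel f' f, cancel g g', cancel g' g &
    @is_iso Q P f' g'].
Proof.
case=> -[f' fK f'K] [g' gK g'K] fi fa [fp gp]; exists f', g'; split=> //; split.
- by exists f.
- by exists g.
- by move=> s; rewrite -fi f'K.
- by move=> s t; have := fa (f' s) (g' t); rewrite f'K g'K => -[-> ->].
- by split=> s; rewrite -?fp -?gp ?f'K ?g'K.
Qed.

Lemma isomorphic_trans P Q R : isomorphic P Q -> isomorphic Q R -> isomorphic P R.
Proof.
move=> [f [g H]] [f' [g' H']]; exists (f' \o f), (g' \o g).
exact: is_iso_comp H H'.
Qed.

Lemma isomorphic_sym P Q : isomorphic P Q -> isomorphic Q P.
Proof. by move=> [f [g /is_iso_sym[f' [g' [_ _ _ _ H]]]]]; exists f', g'. Qed.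

(** The renaming inside [swap], isolated so that swapping becomes composition with an involution. *)
Definition transpose (T : Type) (p q s : T) : T :=
  if `[< s = p >] then q else if `[< s = q >] then p else s.

Lemma transposeK (T : Type) (p q : T) : involutive (transpose p q).
Proof.
move=> s; rewrite /transpose; case: (asboolP (s = p)) => [->|sp].
  by case: asboolP => [-> //|_]; case: asboolP.
case: (asboolP (s = q)) => [->|sq]; first by case: asboolP.
by case: asboolP => //; case: asboolP.
Qed.

Lemma transpose_map (T U : Type) (f : T -> U) p q s : injective f ->
  transpose (f p) (f q) (f s) = f (transpose p q s).
Proof.
move=> fI; have E a b : `[< f a = f b >] = `[< a = b >].
  by apply: asbool_equiv_eq; split=> [/fI | ->].
by rewrite /transpose !E; case: `[< s = p >] => //; case: `[< s = q >].
Qed.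

Lemma is_prefix_swap P Q f g p q : @is_prefix P Q f g ->
  @is_prefix (swap p q) (swap (f p) (f q)) f g.
Proof.
case=> fI gI fi fa fp; split=> //= s t; split; last by case: (fa s t).
rewrite -/(transpose p q s) -/(transpose (f p) (f q) (f s)) transpose_map //.
by case: (fa (transpose p q s) t).
Qed.

Lemma is_iso_swap P Q f g p q : @is_iso P Q f g ->
  @is_iso (swap p q) (swap (f p) (f q)) f g.
Proof.
move=> fg; have [_ _ _ fa _] := is_prefix_swap p q (is_iso_prefix fg).
by case: fg => fb gb fi _ fp; split.
Qed.

Lemma swap_swap P (p q : place (pnet P)) :
  isomorphic (@swap N (swap p q) p q) P.
Proof.
exists id, id; split=> //=; try by exists id.
by move=> s t; rewrite -/(transpose p q s) -/(transpose p q (transpose p q s)) transposeK.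
Qed.

Lemma is_iso_flow_plus P Q f g p q : @is_iso P Q f g ->
  flow_plus (inl (f p)) (inl (f q)) -> flow_plus (inl p) (inl q).
Proof.
move=> /is_iso_sym[f' [g' [fK _ _ _ [_ _ _ fa _]]]].
move=> /(flow_plus_map (h := fun x => match x with inl s => inl (f' s) | inr t => inr (g' t) end)).
rewrite /= !fK; apply=> -[s|t] [s'|t'] //=; first by case: (fa s t') => ->.
by case: (fa s' t) => _ ->.
Qed.

End Morphisms.

Section RunProcess.
Variable N : net.

Notation letter := (option (trans N)).
Notation token := (option nat * eq_place N * nat)%type.
Implicit Types (L : nat -> letter) (c : token -> option nat).

Definition some_of (T : Type) (o : option T) : isSome o -> T :=
  match o with Some t => fun=> t | None => fun h => False_rect T (notF h) end.

Definition run_net L c : prenet :=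
  @PreNet {x : token | valid L x} {j : nat | isSome (L j)}
    (fun x j => c (val x) == Some (val j))
    (fun j x => producer (val x) == Some (val j))
    (fun x => producer (val x) == None).

Definition run_preprocess L c : preprocess N :=
  @PreProcess N (run_net L c) (fun x => label (val x)) (fun j => some_of (valP j)).

Lemma some_ofE (T : Type) (o : option T) (h : isSome o) : o = Some (some_of h).
Proof. by case: o h. Qed.

Lemma run_piT L c (j : trans (run_net L c)) : L (val j) = Some (@piT _ (run_preprocess L c) j).
Proof. exact: some_ofE. Qed.

(** Transition [k] has rank 2k+1 and its products 2k+2, so every arc of a run goes strictly
    upwards. *)
Definition rank (o : option nat) := if o is Some k then k.*2.+2 else 0.

(** The rank of a token may be anything between its producer and its consumer; this freedom is what
    lets two tokens share a rank in [run_unrelated]. *)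
Lemma run_flow_rank L c (R : place (run_net L c) + trans (run_net L c) -> nat) :
  is_run L c ->
  (forall j, R (inr j) = (val j).*2.+1) ->
  (forall x, rank (producer (val x)) <= R (inl x)) ->
  (forall x j, c (val x) = Some j -> R (inl x) < j.*2.+1) ->
  forall x y, flow_plus x y -> R x < R y.
Proof.
move=> cr Rj Rx Rc; apply: flow_plus_mono => -[x|j] [y|i] //=; rewrite lt0b => /eqP.
  by move=> /Rc; rewrite Rj.
by move=> E; rewrite Rj; apply: leq_trans (Rx y); rewrite E.
Qed.

Definition run_rank L c (x : place (run_net L c) + trans (run_net L c)) :=
  match x with inl x => rank (producer (val x)) | inr j => (val j).*2.+1 end.

Lemma run_flow_plus L c x y : is_run L c ->
  flow_plus (N := run_net L c) x y -> run_rank x < run_rank y.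
Proof.
move=> cr; apply: run_flow_rank => // z j cz.
by have [] := is_run_mem cr cz; rewrite /= /rank; case: (producer _) => //= k; lia.
Qed.

Lemma run_producer L x k : valid L x -> producer x = Some k -> isSome (L k).
Proof. by rewrite /valid => + xk; rewrite xk /=; case: (L k). Qed.

Lemma consumed_finite L c j : is_run L c ->
  exists l : seq token, forall x, c x = Some j -> x \in l.
Proof.
move=> cr; have [c1 c2] := cr; case Lj: (L j) => [t|]; last first.
  by exists [::] => x /eqP; rewrite (negbTE (is_run_None _ cr Lj)).
have [f1 _ _] := @net_axiom N t; have [l1 H1] := (@finite_seqP (eq_place N) _).1 f1.
exists (flatten [seq tokens L j s | s <- l1]) => x cx.
apply/flatten_mapP; exists (label x); last exact: c1.
suff: msupp (preT t) (label x) by rewrite H1.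
rewrite /msupp /=; have := c2 j (label x); rewrite Lj /= => <-.
by rewrite -has_count; apply/hasP; exists x; [exact: c1 | exact/eqP].
Qed.

Lemma produced_finite L j :
  exists l : seq token, forall x, valid L x -> producer x = Some j -> x \in l.
Proof.
case Lj: (L j) => [t|]; last by exists [::] => x; rewrite /valid => + xj; rewrite xj /= Lj.
have [_ _ f2] := @net_axiom N t; have [l2 H2] := (@finite_seqP (eq_place N) _).1 f2.
exists (flatten [seq batch (Some j) (post (L j) s) s | s : eq_place N <- l2]) => x xv xj.
apply/flatten_mapP; exists (label x); last first.
  by rewrite mem_batch xj !eqxx /=; move: xv; rewrite /valid xj.
suff: msupp (postT t) (label x) by rewrite H2.
by move: xv; rewrite /valid xj /= Lj /msupp /=; case: (postT t _).
Qed.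

Lemma run_is_process L c : is_run L c -> is_process (run_preprocess L c).
Proof.
move=> cr; have [c1 c2] := cr.
split; first (move=> j; split).
- have [l Hl] := consumed_finite (val j) cr.
  apply: (@finite_set_seq _ _ (pmap insub l)) => x.
  by rewrite /msupp /= /preT /= lt0b mem_pmap_sub => /eqP /Hl.
- have [_ [s Hs] _] := @net_axiom N (@piT _ (run_preprocess L c) j).
  have := c2 (val j) s; rewrite run_piT /= => E; move: Hs; rewrite /msupp /= -E.
  rewrite -has_count => /hasP[x]; rewrite mem_tokens => /and3P[_ _ xv] cx.
  by exists (Sub x xv); rewrite /msupp /preT /= cx.
- have [l Hl] := produced_finite L (val j).
  apply: (@finite_set_seq _ _ (pmap insub l)) => x.
  by rewrite /msupp /= /postT /= lt0b mem_pmap_sub => /eqP /(Hl _ (valP x)).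
split.
  move=> x; split.
  - apply/mcard_le1P; rewrite /preS /=; split=> [j|i j]; first exact: leq_b1.
    by rewrite !lt0b => /eqP -> /eqP[] /val_inj.
  - apply/mcard_le1P; rewrite /postS /=; split=> [j|i j]; first exact: leq_b1.
    by rewrite !lt0b => /eqP -> /eqP[] /val_inj.
  - move=> x0; rewrite /= ; case xk: (producer (val x)) => [k|] //.
    have Lk := run_producer (valP x) xk.
    by have := congr1 (fun A => A (Sub k Lk)) x0; rewrite /preS /= xk eqxx.
  - move=> x0; apply/eqP; rewrite /= eqb0; apply/eqP => xk; apply: x0.
    by apply/funext => j; rewrite /preS /= xk.
split; first by move=> x /(run_flow_plus cr); rewrite ltnn.
split.
  move=> u; apply: (@finite_set_seq _ _ (pmap insub (iota 0 (val u)))) => t /=.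
  move=> /(run_flow_plus cr) /=; rewrite mem_pmap_sub mem_iota /=; lia.
(* Cardinalities are computed on raw tokens and transported to the subtype of valid ones. *)
have sub_card (l : seq token) (s : place N) (A : mset (place (run_net L c))) :
    uniq l -> (forall x, x \in l -> valid L x) ->
    (forall x : place (run_net L c), (val x \in l) <-> label (val x) = s /\ 0 < A x) ->
    mcard (mcap (mset_of (@piS N (run_preprocess L c) @^-1` [set s])) A) (size l).
  move=> lU lv lA.
  have -> : size l = size (pmap insub l : seq {x : token | valid L x}).
    by rewrite size_pmap_sub; apply/esym/eqP; rewrite -all_count; apply/allP.
  apply: (@mcard_fiber_seq {x : token | valid L x}).
    exact: pmap_sub_uniq.
  by move=> x; rewrite mem_pmap_sub; apply: lA.
split.
  move=> s; have -> : init s = size (batch None (@init N s) s) by rewrite size_map size_iota.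
  apply: sub_card => [|x|x].
  (* At index 0 [tokens] is the initial batch by computation, so any sequence of letters will do. *)
  - exact: (tokens_uniq (fun=> None) 0).
  - by rewrite mem_batch /valid => /and3P[/eqP -> /eqP ->].
  - rewrite mem_batch /= lt0b; split=> [/and3P[-> /eqP -> //] | [xs xn]].
    by rewrite xn xs eqxx /=; have := valP x; rewrite /valid (eqP xn) /= xs.
move=> j s; split.
  have := c2 (val j) s; rewrite run_piT /= => E; rewrite -[arcST _ _]E -size_filter.
  apply: sub_card => [|x|x].
  - by rewrite filter_uniq ?tokens_uniq.
  - by rewrite mem_filter mem_tokens => /and4P[].
  - rewrite mem_filter /preT /= lt0b; split=> [/andP[->] | [xs cx]].
      by rewrite mem_tokens => /andP[/eqP].
    by rewrite cx -xs; apply: c1; apply/eqP.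
have -> : arcTS (@piT _ (run_preprocess L c) j) s =
    size (batch (Some (val j)) (post (L (val j)) s) s).
  by rewrite size_map size_iota run_piT.
apply: sub_card => [|x|x].
- by rewrite map_inj_uniq ?iota_uniq // => a b [].
- by rewrite mem_batch /valid => /and3P[/eqP -> /eqP ->].
- rewrite mem_batch /postT /= lt0b; split=> [/and3P[-> /eqP -> //] | [xs xn]].
  by rewrite xn xs eqxx /=; have := valP x; rewrite /valid (eqP xn) /= xs.
Qed.

Definition run_process L c (cr : is_run L c) : process N := Process (run_is_process cr).

End RunProcess.

(** * Swapping tokens of a run *)

Lemma eq_count_sub (T : eqType) (p q : pred T) (l : seq T) :
  {in l, forall x, p x -> q x} -> count p l = count q l -> {in l, forall x, q x -> p x}.
Proof.
move=> pq E x xl qx; apply: contraT => px; move: E.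
rewrite -[count q l]size_filter -(count_predC p) !count_filter.
rewrite [X in _ = X + _](@eq_in_count _ _ p); last first.
  by move=> y yl /=; case: (boolP (p y)) => // /(pq _ yl) ->.
move=> /eqP; rewrite -[X in X == _]addn0 eqn_add2l eq_sym -leqn0 leqNgt -has_count.
by move/hasPn => /(_ x xl); rewrite /= px qx.
Qed.

Section RunSwap.
Variable N : net.

Notation letter := (option (trans N)).
Notation token := (option nat * eq_place N * nat)%type.
Implicit Types (L : nat -> letter) (c : token -> option nat).

(* [x] and [y] are produced before the index [b] and not consumed before it; this makes
   them causally unrelated, also after exchanging their consumers. *)
Definition swappable L c b (x y : token) :=
  [/\ label x = label y, valid L x /\ valid L y,
      before (producer x) b /\ before (producer y) b & unconsumed c b x /\ unconsumed c b y].

Lemma transposeL (T : Type) (p q : T) : transpose p q p = q.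
Proof. by rewrite /transpose; case: asboolP. Qed.

Lemma transposeR (T : Type) (p q : T) : transpose p q q = p.
Proof. by rewrite /transpose; case: asboolP => [->|_] //; case: asboolP. Qed.

Lemma transposeD (T : Type) (p q s : T) : s <> p -> s <> q -> transpose p q s = s.
Proof. by rewrite /transpose; do 2 case: asboolP => //. Qed.

Lemma transposeP (T : Type) (p q s : T) (Q : T -> T -> Prop) :
  Q p q -> Q q p -> (s <> p -> s <> q -> Q s s) -> Q s (transpose p q s).
Proof.
rewrite /transpose; case: asboolP => [-> //|sp]; case: asboolP => [-> //|sq] _ _; exact.
Qed.

Lemma swappable_transpose L c b x y : swappable L c b x y ->
  swappable L (c \o transpose x y) b x y.
Proof.
by case=> ? ? ? [? ?]; split=> //; rewrite /unconsumed /= transposeL transposeR.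
Qed.

Lemma before_trans o j k : before o j -> j <= k -> before o k.
Proof. by case: o => //= i; apply: leq_trans. Qed.

(** Both tokens exist from [b] on and neither is consumed earlier, so each can stand in for the
    other at every consumption; equal labels keep the counts. *)
Lemma transpose_run L c b x y : is_run L c -> swappable L c b x y ->
  is_run L (c \o transpose x y).
Proof.
move=> [c1 c2] [lxy [xv yv] [xb yb] [xu yu]].
have mem_transpose w j s : c w = Some j ->
    (transpose x y w \in tokens L j s) = (w \in tokens L j s).
  apply: (transposeP (Q := fun w w' => c w = Some j -> (w' \in _) = (w \in _))) => // cx.
    move: xu; rewrite /unconsumed cx !mem_tokens lxy xv yv !andbT => bj.
    by rewrite !(before_trans _ bj).
  move: yu; rewrite /unconsumed cx !mem_tokens lxy xv yv !andbT => bj.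
  by rewrite !(before_trans _ bj).
have label_transpose w : label (transpose x y w) = label w.
  exact: (transposeP (Q := fun w w' => label w' = label w)).
split=> [w j /= cw | j s].
  by have := c1 _ _ cw; rewrite label_transpose -(mem_transpose _ _ _ cw) transposeK.
rewrite -c2 -!size_filter -(size_map (transpose x y)).
apply: perm_size; apply: uniq_perm.
- rewrite map_inj_uniq ?filter_uniq ?tokens_uniq //.
  exact: inv_inj (transposeK x y).
- by rewrite filter_uniq ?tokens_uniq.
move=> w; rewrite -{1}[w](transposeK x y) mem_map; last exact: inv_inj (transposeK x y).
rewrite !mem_filter /= transposeK; case: (c w =P Some j) => //= cw.
exact: mem_transpose.
Qed.

Lemma run_swap_iso L c (x y : place (run_net L c)) :
  @is_iso N (@swap N (run_preprocess L c) x y)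
    (run_preprocess L (c \o transpose (val x) (val y))) id id.
Proof.
split=> //; try by exists id.
by move=> s t; split=> //=; rewrite -/(transpose x y s) (transpose_map _ _ _ val_inj).
Qed.

(** Both tokens are given the common rank 2b. It is above their producers, which come before [b],
    and below their consumers, so no chain leads from one to the other. *)
Lemma run_unrelated L c b (x y : place (run_net L c)) : is_run L c ->
  swappable L c b (val x) (val y) -> ~ flow_plus (N := run_net L c) (inl x) (inl y).
Proof.
move=> cr [_ _ [xb yb] [xu yu]].
pose R (z : place (run_net L c) + trans (run_net L c)) := match z with
  | inl z => if (z == x) || (z == y) then b.*2 else rank (producer (val z))
  | inr j => (val j).*2.+1 end.
move/(run_flow_rank (R := R) cr).
have rank_before o : before o b -> rank o <= b.*2 by case: o => //= k; lia.
suff: ~ R (inl x) < R (inl y).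
  move=> H1 H2; apply: H1; apply: H2 => // z /=.
    by case: eqP => [-> | _]; [exact: rank_before|case: eqP => [-> | //]; exact: rank_before].
  move=> j cz; case: eqP => [E | _] /=.
    by move: xu; rewrite /unconsumed -E cz; lia.
  case: eqP => [E | _].
    by move: yu; rewrite /unconsumed -E cz; lia.
  by have [] := is_run_mem cr cz; rewrite /rank; case: (producer _) => //= k; lia.
by rewrite /= !eqxx orbT ltnn.
Qed.

Lemma run_swap_step L c b x y (cr : is_run L c) (cr' : is_run L (c \o transpose x y)) :
  swappable L c b x y -> swap_step (run_process cr) (run_process cr').
Proof.
move=> H; have [lxy [xv yv] B U] := H.
exists (Sub x xv), (Sub y yv); split=> //.
- exact: (run_unrelated (b := b)).
- by apply: (run_unrelated (b := b)) => //=; split=> //; [case: B | case: U].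
- by exists id, id; apply: (run_swap_iso (L := L) (c := c) (Sub x xv) (Sub y yv)).
Qed.

(** The consumers are corrected index by index. At index [n], each token wrongly left out is
    exchanged with a token wrongly consumed, and earlier indices are not disturbed. *)
Lemma run_repair L c c' (cr : is_run L c) (cr' : is_run L c') n :
  exists c2 (cr2 : is_run L c2), swap_eq (run_process cr') (run_process cr2) /\
    forall x i, i < n -> c2 x = Some i <-> c x = Some i.
Proof.
elim: n => [|n [c2 [cr2 [E A]]]]; first by exists c', cr'; split=> //; apply: rt_refl.
have [l0 Hl0] := consumed_finite n cr.
pose l := [seq x <- l0 | c x == Some n].
have lE x : x \in l -> c x = Some n by rewrite mem_filter => /andP[/eqP].
have El x : c x = Some n -> x \in l.
  by move=> cx; rewrite mem_filter cx eqxx; apply: Hl0.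
have: exists c3 (cr3 : is_run L c3), [/\ swap_eq (run_process cr') (run_process cr3),
    forall x i, i < n -> c3 x = Some i <-> c x = Some i &
    forall x, x \in l -> c3 x = Some n].
  (* Induction on the part [m] of [l] that is already consumed at [n]; the other occurrences of [l]
     stay fixed. *)
  have: {subset l <= l} by [].
  move: {1 3}l; elim=> [|x m IH] ml; first by exists c2, cr2; split.
  have [|c3 [cr3 [E3 A3 m3]]] := IH; first by move=> z zm; apply: ml; rewrite inE zm orbT.
  have [c3x | c3x] := eqVneq (c3 x) (Some n).
    by exists c3, cr3; split=> // z; rewrite inE => /orP[/eqP -> // | /m3].
  have cx : c x = Some n by apply/lE/ml; rewrite mem_head.
  (* Both runs consume equally many tokens of this label at [n]. As [x] is missing from those of
     [c3], these cannot all be among those of [c]. *)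
  have [y [lyx yt c3y cy]] : exists y, [/\ label y = label x, y \in tokens L n (label x),
      c3 y = Some n & c y <> Some n].
    apply: contrapT => H; have xt := cr.1 _ _ cx.
    have := @eq_count_sub _ (fun y => c3 y == Some n) (fun y => c y == Some n)
      (tokens L n (label x)).
    rewrite cr.2 cr3.2 => /(_ _ erefl x xt); rewrite cx eqxx (negbTE c3x).
    suff S : {in tokens L n (label x), forall y, c3 y == Some n -> c y == Some n}.
      by move=> /(_ S isT).
    move=> y yt /eqP c3y; apply/eqP; apply: contrapT => cy; apply: H.
    by exists y; split=> //; move: yt; rewrite mem_tokens => /andP[/eqP].
  have H : swappable L c3 n y x.
    have [yb yv] := is_run_mem cr3 c3y; have [xb xv] := is_run_mem cr cx.
    split=> //; rewrite /unconsumed c3y leqnn; split=> //.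
    (* An earlier consumer of [x] in [c3] would also be its consumer in [c], which is [n]. *)
    case c3x': (c3 x) => [i|] //; rewrite leqNgt; apply/negP => iN.
    by have := (A3 x i iN).1 c3x'; rewrite cx => -[iE]; rewrite iE ltnn in iN.
  have cr4 := transpose_run cr3 H.
  exists (c3 \o transpose y x), cr4; split.
  - by apply: rt_trans E3 _; apply: rt_step; apply: run_swap_step H.
  - move=> z i iN /=; rewrite -A3 //.
    apply: (transposeP (Q := fun z w => c3 w = Some i <-> c3 z = Some i)) => //.
    + rewrite c3y; split=> [c3i | [iE]]; last by rewrite iE ltnn in iN.
      by have := (A3 x i iN).1 c3i; rewrite cx => -[iE]; rewrite iE ltnn in iN.
    + rewrite c3y; split=> [[iE] | c3i]; first by rewrite iE ltnn in iN.
      by have := (A3 x i iN).1 c3i; rewrite cx => -[iE]; rewrite iE ltnn in iN.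
  - move=> z; rewrite inE => /orP[/eqP -> | zm] /=; first by rewrite transposeR.
    rewrite transposeD ?m3 // => zE.
      by apply: cy; rewrite -zE; apply/lE/ml; rewrite inE zm orbT.
    by have := m3 z zm; rewrite zE => /eqP; rewrite (negbTE c3x).
move=> [c3 [cr3 [E3 A3 l3]]]; exists c3, cr3; split=> // x i.
rewrite ltnS leq_eqVlt => /orP[/eqP -> | ]; last exact: A3.
split=> [c3x | /El /l3 //]; apply/eqP.
(* Every token that [c] consumes at [n] is now consumed there; equal counts leave no room for
   another. *)
have := @eq_count_sub _ (fun y => c y == Some n) (fun y => c3 y == Some n)
      (tokens L n (label x)).
rewrite cr.2 cr3.2; apply=> //; first by move=> y _ /eqP/El/l3/eqP.
- exact: cr3.1.
- exact/eqP.
Qed.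

(** Beyond [n] there is nothing to consume, so agreement below [n] is equality of the consumer
    functions. *)
Lemma run_swap_eq L c c' (cr : is_run L c) (cr' : is_run L c') n :
  (forall j, n <= j -> L j = None) -> swap_eq (run_process cr') (run_process cr).
Proof.
move=> Ln; have [c2 [cr2 [E A]]] := run_repair cr cr' n.
suff Ec : c2 = c by case: _ / Ec cr cr2 E {A} => cr cr2; rewrite (Prop_irrelevance cr2 cr).
apply/funext => x.
have lt c0 i : is_run L c0 -> c0 x = Some i -> i < n.
  move=> r0 E0; rewrite ltnNge; apply/negP => /Ln /(is_run_None x r0).
  by rewrite E0 eqxx.
case c2x: (c2 x) => [i|]; first by apply/esym/A => //; apply: lt c2x.
case cx: (c x) => [i|] //.
by have := (A x i (lt _ _ cr cx)).2 cx; rewrite c2x.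
Qed.

End RunSwap.

(** * Linearizing a process *)

Lemma inj_surj_bij (T U : Type) (f : T -> U) :
  injective f -> (forall y, exists x, f x = y) -> bijective f.
Proof.
move=> fI /boolp.choice[g fg]; exists g => // x.
by apply: fI; rewrite fg.
Qed.

Lemma mem_index_ex (T : eqType) (l : seq T) i : uniq l -> i < size l ->
  exists2 x, x \in l & index x l = i.
Proof.
case: l => // x0 l lU il; exists (nth x0 (x0 :: l) i); first exact: mem_nth.
exact: index_uniq.
Qed.

(** The exponent is the 2-adic valuation, so it can be cancelled. This makes the numbering of
    [linearization_exists] injective. *)
Lemma odd_part_inj a b k l : (a.*2.+1) * 2 ^ k = (b.*2.+1) * 2 ^ l -> a = b.
Proof.
have log2 m j : logn 2 (m.*2.+1 * 2 ^ j) = j.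
  rewrite lognM ?expn_gt0 // lognX (@pfactorK 2 1) // muln1 lognE /=.
  by rewrite dvdn2 /= odd_double.
move=> E; have kl : k = l by rewrite -(log2 a k) E log2.
by move/eqP: E; rewrite kl eqn_pmul2r ?expn_gt0 // => /eqP[] /double_inj.
Qed.

Section ProcessFacts.
Variables (N : net) (P : process N).
Notation K := (pnet P).
Implicit Types (s p q : place K) (t u : trans K).

Lemma arcTS_le1 t s : arcTS t s <= 1.
Proof. by have [_ [/(_ s)[/mcard_le1P[+ _] _ _ _] _]] := process_axiom P; apply. Qed.

Lemma arcST_le1 t s : arcST s t <= 1.
Proof. by have [_ [/(_ s)[_ /mcard_le1P[+ _] _ _] _]] := process_axiom P; apply. Qed.

Lemma producer_uniq s t u : 0 < arcTS t s -> 0 < arcTS u s -> t = u.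
Proof. by have [_ [/(_ s)[/mcard_le1P[_ +] _ _ _] _]] := process_axiom P; apply. Qed.

Lemma consumer_uniq s t u : 0 < arcST s t -> 0 < arcST s u -> t = u.
Proof. by have [_ [/(_ s)[_ /mcard_le1P[_ +] _ _] _]] := process_axiom P; apply. Qed.

Lemma init_produced s t : 0 < arcTS t s -> init s = 0.
Proof.
have [_ [/(_ s)[_ _ _ H] _]] := process_axiom P => ts; apply: H => E.
by move: ts; rewrite -[arcTS t s]/(preS s t) E.
Qed.

Lemma init_or_produced s : init s = 1 \/ exists t, 0 < arcTS t s.
Proof.
have [_ [/(_ s)[_ _ H _] _]] := process_axiom P.
have [E|/existsNP[t ts]] := EM (forall t, preS s t = 0).
  by left; apply: H; apply/funext.
by right; exists t; move: ts; rewrite /preS; case: arcTS.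
Qed.

Lemma acyclic x : ~ flow_plus (N := K) x x.
Proof. by have [_ [_ [+ _]]] := process_axiom P; apply. Qed.

Lemma past_finite u : finite_set [set t : trans K | flow_plus (inr t) (inr u)].
Proof. by have [_ [_ [_ [+ _]]]] := process_axiom P; apply. Qed.

Lemma init_fiber (s : place N) : exists l : seq {classic place K},
  [/\ uniq l, size l = init s &
      forall x : {classic place K}, (x \in l) <-> piS x = s /\ 0 < init x].
Proof. by have [_ [_ [_ [_ [/(_ s)/mcard_fiber + _]]]]] := process_axiom P. Qed.

Lemma pre_fiber t (s : place N) : exists l : seq {classic place K},
  [/\ uniq l, size l = arcST s (piT t) &
      forall x : {classic place K}, (x \in l) <-> piS x = s /\ 0 < arcST x t].
Proof. by have [_ [_ [_ [_ [_ /(_ t s)[/mcard_fiber + _]]]]]] := process_axiom P. Qed.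

Lemma post_fiber t (s : place N) : exists l : seq {classic place K},
  [/\ uniq l, size l = arcTS (piT t) s &
      forall x : {classic place K}, (x \in l) <-> piS x = s /\ 0 < arcTS t x].
Proof. by have [_ [_ [_ [_ [_ /(_ t s)[_ /mcard_fiber +]]]]]] := process_axiom P. Qed.

Lemma nonempty_pre t : exists s, 0 < arcST s t.
Proof. by have [/(_ t)[_ [s]]] := process_axiom P; exists s. Qed.

(** Gaps in the numbering are allowed; they become idle letters. *)
Definition linearization (g : trans K -> nat) :=
  injective g /\ forall t s u, 0 < arcTS t s -> 0 < arcST s u -> g t < g u.

(** The letters are read off along [g], and each place is turned into a token carrying the number of
    its producer. The only arbitrary choice is the order of the places with the same producer and
    label. *)
Lemma linearization_run g : linearization g ->
  exists L c (cr : is_run L c) f h,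
    @is_iso N P (run_preprocess L c) f h /\ forall t, val (h t) = g t.
Proof.
move=> [gI gM].
have /boolp.choice[prod prodP] : forall s, exists o, forall t, o = Some t <-> 0 < arcTS t s.
  move=> s; have [E|[t ts]] := init_or_produced s.
    by exists None => t; split=> // /init_produced; rewrite E.
  by exists (Some t) => u; split=> [[<-] // | us]; rewrite (producer_uniq ts us).
have prodN s : prod s = None <-> 0 < init s.
  have [E|[t ts]] := init_or_produced s; last first.
    by rewrite (init_produced ts); split=> // sN; have := (prodP s t).2 ts; rewrite sN.
  rewrite E; split=> // _; case st: (prod s) => [t|] //.
  by have := init_produced ((prodP s t).1 st); rewrite E.
have /boolp.choice[L LP] : forall j, exists a, (forall t, g t = j -> a = Some (piT t)) /\
    (isSome a -> exists t, g t = j).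
  move=> j; have [[t tj]|H] := EM (exists t, g t = j).
    exists (Some (piT t)); split=> [u uj | _]; last by exists t.
    by congr (Some (piT _)); apply: gI; rewrite uj.
  by exists None; split=> // t tj; case: H; exists t.
have LE t : L (g t) = Some (piT t) by apply: (LP _).1.
have /boolp.choice[fib fibP] : forall os : option (trans K) * place N,
    exists l : seq {classic place K},
    [/\ uniq l, size l = created L (omap g os.1) os.2 &
      forall x : {classic place K}, (x \in l) <-> piS x = os.2 /\ prod x = os.1].
  move=> [[t|] s] /=.
    have [l [lU ls lP]] := post_fiber t s; exists l; rewrite LE; split=> // x.
    by rewrite lP; split=> -[-> /prodP].
  have [l [lU ls lP]] := init_fiber s; exists l; split=> // x.
  by rewrite lP; split=> -[-> /prodN].
(* The position in the chosen enumeration of the fiber serves as the number of the token; the size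
   of the fiber is exactly the bound required by [valid]. *)
pose F (x : {classic place K}) : option nat * eq_place N * nat :=
  (omap g (prod x), piS x, index (x : {classic place K}) (fib (prod x, piS x))).
have in_fib (x : place K) : (x : {classic place K}) \in fib (prod x, piS x).
  by have [_ _ H] := fibP (prod x, piS x); apply/H.
have Fv x : valid L (F x).
  have [_ E _] := fibP (prod x, piS x).
  by move: (in_fib x); rewrite -index_mem E.
have omapI : injective (omap g) by move=> [?|] [?|] //= [] /gI ->.
have FI : injective F.
  move=> x y [] /omapI xy sxy; rewrite -sxy -xy => /index_inj -> //.
  have := in_fib y; by rewrite -sxy -xy.
have Fsurj x : valid L x -> exists p, F p = x.
  move=> xv.
  have [o xo] : exists o, producer x = omap g o.
    case xk: (producer x) => [k|]; last by exists None.
    by have /(LP k).2[t tk] := run_producer xv xk; exists (Some t); rewrite /= tk.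
  have [lU ls lP] := fibP (o, label x).
  have [|p /lP[px po] pE] := @mem_index_ex _ (fib (o, label x)) x.2 lU.
    by rewrite ls; move: xv; rewrite /valid xo.
  exists p; rewrite /F po px pE /= -xo.
  by case: (x) => [[]].
have /boolp.choice[c cP] : forall x, exists o, forall j, o = Some j <->
    exists p u, [/\ F p = x, 0 < arcST p u & g u = j].
  move=> x; have [[p [u [px pu]]]|H] := EM (exists p u, F p = x /\ 0 < arcST p u).
    exists (Some (g u)) => j; split=> [[<-] | [p' [u' [px' pu' <-]]]]; first by exists p, u.
    move: px'; rewrite -px => /FI pp; rewrite pp in pu'.
    by rewrite (consumer_uniq pu pu').
  by exists None => j; split=> // -[p [u [px pu _]]]; case: H; exists p, u.
have cr : is_run L c.
  have c1 x j : c x = Some j -> x \in tokens L j (label x).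
    move=> /cP[p [u [<- pu <-]]]; rewrite mem_tokens eqxx Fv andbT /= /producer /=.
    by case pt: (prod p) => [t|] //=; apply: gM pu; apply/prodP.
  split=> // j s.
  have [[u uj]|H] := EM (exists u, g u = j); last first.
    have -> : L j = None.
      by case Lj: (L j) => [t|] //; case: H; apply: (LP j).2; rewrite Lj.
    apply/eqP; rewrite -leqn0 leqNgt -has_count; apply/hasPn => x _.
    by apply/eqP => /cP[p [u [_ _ uj]]]; apply: H; exists u.
  have [l [lU ls lP]] := pre_fiber u s.
  rewrite -uj LE /= -[preT _ _]ls -(size_map F) -size_filter.
  apply: perm_size; apply: uniq_perm; first by rewrite filter_uniq ?tokens_uniq.
    by rewrite map_inj_uniq.
  move=> x; rewrite mem_filter; apply/andP/mapP.
    move=> [/eqP/cP[p [u' [px pu /gI uu]]] xs]; exists p => //; apply/lP.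
    rewrite -uu; split=> //; move: xs; rewrite mem_tokens -px => /andP[/eqP <- _] //.
  move=> [p /lP[ps pu] ->]; have cF : c (F p) = Some (g u) by apply/cP; exists p, u.
  by rewrite cF eqxx; split=> //; have := c1 _ _ cF; rewrite /label /= ps.
have gs t : isSome (L (g t)) by rewrite LE.
exists L, c, cr, (fun x => Sub (F x) (Fv x)), (fun t => Sub (g t) (gs t)); split=> //.
split.
- apply: inj_surj_bij; first by move=> x y [] *; apply: FI; congr (_, _, _).
  by move=> [x xv]; have [p px] := Fsurj x xv; exists p; apply: val_inj.
- apply: inj_surj_bij; first by move=> x y [/gI].
  by move=> [j Lj]; have [t tj] := (LP j).2 Lj; exists t; apply: val_inj.
- move=> s /=; rewrite /producer /=.
  have [E|[t ts]] := init_or_produced s; first by rewrite E ((prodN s).2) ?E.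
  by rewrite (init_produced ts) ((prodP s t).2 ts).
- move=> s t /=; split.
    have := arcST_le1 t s; case E: (arcST s t) => [|[|]] // _; last first.
      by rewrite ((cP _ (g t)).2) ?eqxx //; exists s, t; rewrite E.
    apply/eqP; rewrite eqb0; apply/eqP => /cP[p [u [/FI -> pu /gI ut]]].
    by rewrite ut E in pu.
  have := arcTS_le1 t s; rewrite /producer /=; case E: (arcTS t s) => [|[|]] // _; last first.
    by rewrite ((prodP s t).2) ?eqxx // E.
  case st: (prod s) => [u|] //=; apply/eqP; rewrite eqb0; apply/eqP => -[/gI ut].
  by have := (prodP s u).1 st; rewrite ut E.
- split=> // t; apply: Some_inj.
  by rewrite -(@run_piT N L c (Sub (g t) (gs t))); apply: LE.
Qed.

Lemma producer_past s t u : 0 < arcTS t s -> 0 < arcST s u ->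
  flow_plus (N := K) (inr t) (inr u).
Proof. by move=> ts su; apply: (t_trans _ _ _ (inl s)); apply: t_step. Qed.

Lemma past_seq : exists past : trans K -> seq {classic trans K}, forall u,
  uniq (past u) /\ forall t, (t : {classic trans K}) \in past u <-> flow_plus (inr t) (inr u).
Proof.
suff /boolp.choice[past H] : forall u : trans K, exists l : seq {classic trans K},
    uniq l /\ forall t, (t : {classic trans K}) \in l <-> flow_plus (inr t) (inr u).
  by exists past.
by move=> u; have [l lU lP] := finite_set_classic_seq (past_finite u); exists l.
Qed.

(** The types underlying a process are arbitrary, so this needs an argument. There are countably
    many initial places, a finite fiber over each place of [N], and finitely many arcs leave each
    node, hence each level [D n] is countable; finite pasts put every transition on some level. *)
Lemma countable_trans : countable_net N -> countable [set: trans K].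
Proof.
move=> [cS _]; have [past pastP] := past_seq.
pose Pl (A : set (trans K)) := [set s | 0 < init s] `|` \bigcup_(t in A) msupp (postT t).
pose D := fix D n := if n is n'.+1 then \bigcup_(s in Pl (D n')) msupp (postS s) else set0.
have Dc n : countable (D n).
  elim: n => [|n IH] /=; first exact: countable0.
  apply: bigcup_countable => [|s _]; last first.
    apply: finite_set_countable.
    by have [_ [/(_ s)[_ [k _ []]]]] := process_axiom P.
  rewrite /Pl -bigcup2E; apply: bigcup_countable => // -[|[|i]] _ /=.
  - apply: (@sub_countable _ _ _ (\bigcup_(s in [set: place N])
      [set x : place K | piS x = s /\ 0 < init x])).
      by apply: subset_card_le => s s0; exists (piS s).
    apply: bigcup_countable => // s _; apply: finite_set_countable.
    have [l [lU _ lP]] := init_fiber s.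
    by apply: (@finite_set_seq {classic place K} _ l) => x /lP.
  - apply: bigcup_countable => // t _; apply: finite_set_countable.
    by have [/(_ t)[]] := process_axiom P.
  - exact: countable0.
apply: (@sub_countable _ _ _ (\bigcup_(n in [set: nat]) D n)); last first.
  by apply: bigcup_countable => // n _.
apply: subset_card_le => u _.
(* One preplace of [u] suffices: it is initial, or its producer has a strictly smaller past. *)
have [m] := ubnP (size (past u)); elim: m u => // m IH u um.
have [s su] := nonempty_pre u.
have [E|[t ts]] := init_or_produced s.
  by exists 1 => //; exists s => //; left; rewrite /= E.
have tu := producer_past ts su.
have [|n _ tn] := IH t.
  rewrite -ltnS; apply: leq_trans um; rewrite !ltnS.
  apply: (@uniq_leq_size _ ((t : {classic trans K}) :: past t)).
    rewrite /= (pastP t).1 andbT; apply/negP => /(pastP t).2; exact: acyclic.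
  move=> v; rewrite inE => /orP[/eqP -> | /(pastP t).2 vt]; first by apply/(pastP u).2.
  by apply/(pastP u).2; apply: t_trans vt tu.
by exists n.+1 => //; exists s => //; right; exists t.
Qed.

(** With [e] an injective numbering, [u] gets (2e(u)+1) 2^k(u), where k(u) sums 2e(t)+1 over the
    strict past of [u]. The odd part gives injectivity. If t precedes u then k(u) is at least
    k(t)+2e(t)+1, and 2^(2e(t)+1) exceeds 2e(t)+1. *)
Lemma linearization_exists : countable_net N -> exists g, linearization g.
Proof.
move=> Nc; have [e eI] := countable_injP _ (countable_trans Nc).
have [past pastP] := past_seq.
pose k u := \sum_(t <- past u) (e t).*2.+1.
exists (fun u => (e u).*2.+1 * 2 ^ k u); split=> [t u /odd_part_inj tu | t s u ts su].
  by apply: eI; rewrite ?inE.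
have tu := producer_past ts su.
have ku : k t + (e t).*2.+1 <= k u.
  rewrite addnC -(big_cons _ _ (t : {classic trans K}) (past t) xpredT (fun t => (e t).*2.+1)).
  apply: uniq_sub_le_big => //=; first by move=> *; exact: leq_addr.
    rewrite (pastP t).1 andbT; apply/negP => /(pastP t).2; exact: acyclic.
  - exact: (pastP u).1.
  move=> v; rewrite inE => /orP[/eqP -> | /(pastP t).2 vt]; first by apply/(pastP u).2.
  by apply/(pastP u).2; apply: t_trans vt tu.
apply: (@leq_trans (2 ^ k u)); last by rewrite leq_pmull.
apply: leq_trans (leq_pexp2l _ ku) => //.
by rewrite expnD mulnC ltn_pmul2l ?expn_gt0 // ltn_expl.
Qed.

(** Everything outside [A] is delayed by a bound on the numbers used in [A]; as [A] contains its own
    past, no arc is reversed. *)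
Lemma linearization_front g (A : set (trans K)) : linearization g ->
  finite_set A -> (forall t s u, 0 < arcTS t s -> 0 < arcST s u -> A u -> A t) ->
  exists g' b, linearization g' /\ forall t, A t <-> g' t < b.
Proof.
move=> [gI gM] Afin Ac; have [l lU lA] := finite_set_classic_seq Afin.
pose b := (\sum_(t <- l) g t).+1.
have gb t : A t -> g t < b.
  by move=> /lA tl; rewrite ltnS (big_rem _ tl) leq_addr.
exists (fun t => if `[< A t >] then g t else g t + b), b; split; last first.
  move=> t; case: asboolP => At; split=> //; first by move=> _; apply: gb.
  by rewrite ltnNge leq_addl.
split=> [t u|t s u ts su].
  case: asboolP => At; case: asboolP => Au; try exact: gI.
  - by have := gb t At; lia.
  - by have := gb u Au; lia.
  - by move/addIn/gI.
have := gM _ _ _ ts su; case: asboolP => At; case: asboolP => Au; try lia.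
by case: At; apply: Ac ts su Au.
Qed.

End ProcessFacts.

(** * Swaps, prefixes and BD *)

Lemma flow_plus_last (K : prenet) x (p : place K) : flow_plus x (inl p) ->
  exists2 u, 0 < arcTS u p & x = inr u \/ flow_plus x (inr u).
Proof.
move: {2 3}(inl p) (erefl (inl p : place K + trans K)) => y E H.
elim: H E => [a b ab E|a b d ab _ bd IH /IH[u up [E|bu]]].
- move: ab; rewrite -E; case: a => [s|u] //= up; exists u; by [|left].
- by exists u => //; right; rewrite -E.
- by exists u => //; right; apply: t_trans ab bu.
Qed.

(** * Causal closure of prefixes *)

Section Prefix.
Variables (N : net) (P X : process N).
Variables (f : place (pnet P) -> place (pnet X)) (g : trans (pnet P) -> trans (pnet X)).
Hypothesis fg : is_prefix f g.

(** [f s] is not initial, hence neither is [s]; so [s] already has a producer in [P], and producers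
    are unique. *)
Lemma prefix_producer t s : 0 < arcTS t (f s) -> exists2 u, t = g u & 0 < arcTS u s.
Proof.
case: fg => _ gI [fi _] fa _ ts; have s0 := fi s; rewrite (init_produced ts) in s0.
have [E|[u us]] := init_or_produced s; first by rewrite -s0 in E.
exists u => //; apply: producer_uniq ts _.
by case: (fa s u) => _ ->.
Qed.

(** For each label, [t] and [g t] have equally many preplaces, as prescribed by the net, so the
    images of the former exhaust the latter. *)
Lemma prefix_consumed s t : 0 < arcST s (g t) -> exists2 p, s = f p & 0 < arcST p t.
Proof.
case: fg => fI _ _ fa [fp gp] st.
have [l [lU ls lP]] := pre_fiber (g t) (piS s).
have [l' [lU' ls' lP']] := pre_fiber t (piS s).
have fl : uniq (map f l' : seq {classic place (pnet X)}) by rewrite (@map_inj_uniq {classic _}).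
have sub : {subset (map f l' : seq {classic place (pnet X)}) <= l}.
  move=> x /(@mapP {classic _})[p /lP'[ps pt] ->]; apply/lP.
  by rewrite fp; split=> //; case: (fa p t) => ->.
have [|_ E] := uniq_min_size fl sub; first by rewrite size_map ls ls' gp.
have : (s : {classic _}) \in (map f l' : seq {classic place (pnet X)}).
  by rewrite E; apply/lP.
move=> /(@mapP {classic _})[p /lP'[_ pt] ->]; by exists p.
Qed.

Definition prefix_map (x : place (pnet P) + trans (pnet P)) :=
  match x with inl s => inl (f s) | inr t => inr (g t) end.

(** The image is closed under predecessors, so a larger process adds no causality inside a
    prefix. *)
Lemma prefix_flow_plus x y : flow_plus x (prefix_map y) ->
  exists2 z, x = prefix_map z & flow_plus z y.
Proof.
move E: (prefix_map y) => w H; elim: H y E => [a b ab y E|a b d _ IH1 _ IH2 y E].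
  rewrite -E in ab; case: y a ab {E} => [s|t] [s'|t'] //=.
    by move/prefix_producer => [u -> us]; exists (inr u) => //; apply: t_step.
  by move/prefix_consumed => [p -> pt]; exists (inl p) => //; apply: t_step.
have [z zE zy] := IH2 y E; have [z' z'E z'z] := IH1 z (esym zE).
by exists z' => //; apply: t_trans z'z zy.
Qed.

Lemma prefix_unrelated p q : ~ flow_plus (inl p) (inl q) ->
  ~ flow_plus (inl (f p) : place _ + trans _) (inl (f q)).
Proof.
move=> pq /(@prefix_flow_plus _ (inl q))[[s|t] //= [sE]].
by case: fg => fI _ _ _ _; move/fI: sE => <-.
Qed.

End Prefix.

(** * Lifting swaps along prefixes; normal form of BD *)

Section SwapLift.
Variables (N : net).
Hypothesis Nc : countable_net N.
Implicit Types P Q X : process N.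

(** The pasts of [p] and [q] are scheduled first. Afterwards both tokens are present, and a consumer
    scheduled too early would lie in one of these pasts, contradicting acyclicity or the lack of
    causal relation. *)
Lemma unrelated_run X (p q : place (pnet X)) : piS p = piS q ->
  ~ flow_plus (inl p) (inl q) -> ~ flow_plus (inl q) (inl p) ->
  exists L c (cr : is_run L c) f h b,
    @is_iso N X (run_preprocess L c) f h /\ swappable L c b (val (f p)) (val (f q)).
Proof.
move=> lpq pq qp; have [g0 g0l] := linearization_exists X Nc.
pose A := [set t : trans (pnet X) | flow_plus (inr t) (inl p) \/ flow_plus (inr t) (inl q)].
have [||g [b [gl gb]]] := @linearization_front N X g0 A g0l.
- have fin (s : place (pnet X)) : finite_set [set t : trans (pnet X) | flow_plus (inr t) (inl s)].
    have [E|[u us]] := init_or_produced s.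
      apply: (@sub_finite_set _ _ set0) => // t /flow_plus_last[u us _].
      by rewrite (init_produced us) in E.
    apply: (@sub_finite_set _ _ ([set u] `|` [set t | flow_plus (inr t) (inr u)])).
      move=> t /flow_plus_last[v vs]; rewrite (producer_uniq vs us).
      by case=> [[->]|]; [left|right].
    by rewrite finite_setU; split; [exact: finite_set1 | exact: past_finite].
  apply: (@sub_finite_set _ _ ([set t | flow_plus (inr t) (inl p)] `|`
    [set t | flow_plus (inr t) (inl q)])) => //.
  by rewrite finite_setU.
- by move=> t s u ts su [up|uq]; [left|right]; [apply: t_trans up|apply: t_trans uq];
    apply: producer_past su.
have [L [c [cr [f [h [fh hg]]]]]] := linearization_run gl.
exists L, c, cr, f, h, b; split=> //.
have [[f' fK f'K] [h' hK h'K] _ fa [fp hp]] := fh.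
have out (s s' : place (pnet X)) : ~ flow_plus (inl s) (inl s') ->
    forall j (u : trans (run_net L c)), c (val (f s)) = Some j -> j = val u -> 
    ~ flow_plus (inr (h' u)) (inl s').
  move=> ss j u cs ju us; apply: ss; apply: t_trans us; apply: t_step => /=.
  by have [<- _] := fa s (h' u); rewrite h'K /= cs ju eqxx.
have index s j : c (val (f s)) = Some j -> exists u : trans (run_net L c), j = val u.
  move=> cs; have : isSome (L j).
    by case Lj: (L j) => //; have := is_run_None (val (f s)) cr Lj; rewrite cs eqxx.
  by move=> Lj; exists (Sub j Lj).
have befP s (H : forall t, flow_plus (inr t) (inl s) -> A t) : before (producer (val (f s))) b.
  case fs: (producer (val (f s))) => [k|] //=.
  have Lk := run_producer (valP (f s)) fs.
  have kE : k = g (h' (Sub k Lk)) by rewrite -hg h'K.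
  rewrite kE; apply/gb/H; apply: t_step => /=.
  by have [_ <-] := fa s (h' (Sub k Lk)); rewrite h'K /= fs eqxx.
have consP s : (forall u, 0 < arcST s u -> ~ A u) -> unconsumed c b (val (f s)).
  move=> H; rewrite /unconsumed; case cs: (c (val (f s))) => [j|] //.
  have [u ju] := index _ _ cs; rewrite leqNgt; apply/negP => jb.
  apply: (H (h' u)); last by apply/gb; rewrite -hg h'K -ju.
  by have [<- _] := fa s (h' u); rewrite h'K /= cs ju eqxx.
split.
- by have := fp p; have := fp q; rewrite /= => -> ->.
- by split; apply: valP.
- by split; apply: befP => t; [left|right].
- split; apply: consP => u su [up|uq].
  + by apply: (@acyclic _ X (inl p)); apply: t_trans up; apply: t_step.
  + by apply: pq; apply: t_trans uq; apply: t_step.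
  + by apply: qp; apply: t_trans up; apply: t_step.
  + by apply: (@acyclic _ X (inl q)); apply: t_trans uq; apply: t_step.
Qed.

(** Symmetry of [swap_step]. What has to be shown is that the two places remain unrelated after the
    swap, which is visible in a run where they coexist. *)
Lemma swap_step_back Q P : swap_step Q P -> exists p q : place (pnet P),
  [/\ ~ flow_plus (inl p) (inl q), ~ flow_plus (inl q) (inl p),
      piS p = piS q & isomorphic (swap p q) Q].
Proof.
move=> [p [q [pq qp lpq [f1 [g1 H1]]]]].
have [L [c [cr [f [h [b [fh sw]]]]]]] := unrelated_run lpq pq qp.
have cr' := transpose_run cr sw; have sw' := swappable_transpose sw.
have H2 := is_iso_comp (is_iso_swap p q fh) (run_swap_iso (f p) (f q)).
have [f3 [g3 [f3K _ _ _ H3]]] := is_iso_sym H2.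
have unrel x y : flow_plus (N := pnet P) (inl (f1 x)) (inl (f1 y)) ->
    flow_plus (N := run_net L (c \o transpose (val (f p)) (val (f q)))) (inl (f x)) (inl (f y)).
  move/(is_iso_flow_plus H1) => H; apply: (is_iso_flow_plus H3).
  by move: H; rewrite -{1}(f3K x) -{1}(f3K y).
exists (f1 p), (f1 q); split.
- by move/unrel; apply: run_unrelated sw'.
- move/unrel; apply: (run_unrelated (b := b) cr').
  by case: sw' => [? [? ?] [? ?] [? ?]]; split.
- by case: H1 => _ _ _ _ [E _]; rewrite !E.
- apply: isomorphic_trans (swap_swap p q); apply: isomorphic_sym.
  by exists f1, g1; exact: (@is_iso_swap N (swap p q) P f1 g1 p q H1).
Qed.

(** The reversed swap, from [P] to [Q], is performed on the images of the two places in [X], which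
    are still unrelated there. *)
Lemma swap_step_prefix Q P X : swap_step Q P -> prefix_of P X ->
  exists2 X', prefix_of Q X' & swap_step X' X.
Proof.
move=> /swap_step_back[p [q [pq qp lpq QP]]] [f1 [g1 H1]].
have lpq' : piS (f1 p) = piS (f1 q) by case: H1 => _ _ _ _ [E _]; rewrite !E.
have [L [c [cr [f [h [b [fh sw]]]]]]] :=
  unrelated_run lpq' (prefix_unrelated H1 pq) (prefix_unrelated H1 qp).
have cr' := transpose_run cr sw; have sw' := swappable_transpose sw.
(* Swapping directly in [X] would give a mere preprocess; the swapped run is a process by
   construction. *)
exists (run_process cr').
  apply: (preprefix_trans (preprefix_iso (isomorphic_sym QP))).
  apply: (@preprefix_trans _ _ (swap (f1 p) (f1 q))).
    by exists f1, g1; apply: is_prefix_swap.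
  apply: (@preprefix_trans _ _ (@swap N (run_preprocess L c) (f (f1 p)) (f (f1 q)))).
    by apply: preprefix_iso; exists f, h; apply: is_iso_swap.
  by apply: preprefix_iso; exists id, id; apply: run_swap_iso.
pose tr := transpose (val (f (f1 p))) (val (f (f1 q))).
have Ec : (c \o tr) \o tr = c by apply/funext => x /=; rewrite /tr transposeK.
have cr2 : is_run L ((c \o tr) \o tr) by rewrite Ec.
have [x [y [xy yx lxy iso]]] := run_swap_step cr' cr2 sw'.
exists x, y; split=> //; apply: isomorphic_trans iso _.
by rewrite /= Ec; apply: isomorphic_sym; exists f, h.
Qed.

Lemma swap_eq_prefix Q P X : swap_eq Q P -> prefix_of P X ->
  exists2 X', prefix_of Q X' & swap_eq X' X.
Proof.
move=> H; elim: H X => [A B AB X BX|A X AX|A B D _ IH1 _ IH2 X DX].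
- have [X' AX' X'X] := swap_step_prefix AB BX.
  by exists X' => //; apply: rt_step.
- by exists X => //; apply: rt_refl.
have [X1 BX1 X1X] := IH2 _ DX; have [X2 AX2 X2X1] := IH1 _ BX1.
by exists X2 => //; apply: rt_trans X2X1 X1X.
Qed.

Lemma prefix_of_trans P Q X : prefix_of P Q -> prefix_of Q X -> prefix_of P X.
Proof. exact: preprefix_trans. Qed.

Lemma prefix_of_refl P : prefix_of P P.
Proof. by apply: preprefix_iso; exists id, id; split=> //; exists id. Qed.

(** All swaps are gathered between two prefix steps: a swap below a prefix is pushed above it by
    [swap_eq_prefix]. *)
Lemma BDP P C : BD P C <-> exists R Q P', [/\ C = swap_class R, pfinite R,
  prefix_of R Q, swap_eq Q P' & prefix_of P' P /\ pfinite P'].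
Proof.
split.
  move=> [_ [D [P' [P'P P'fin ->]] [P1 [P2 [P1fin P2fin -> E [Q' [Q [PQ' QQ' QP2]]]]]]]].
  have P2P' : swap_eq P2 P'.
    have : swap_class P2 P2 by apply: rt_refl.
    by rewrite -E.
  have [Q1 P1Q1 Q1Q] := swap_eq_prefix PQ' QQ'.
  exists P1, Q1, P'; split=> //.
  by apply: rt_trans Q1Q _; apply: rt_trans QP2 P2P'.
move=> [R [Q [P' [-> Rfin RQ QP' [P'P P'fin]]]]].
split; first by exists R.
exists (swap_class P'); first by exists P'.
exists R, P'; split=> //; exists R, Q; split=> //.
exact: rt_refl.
Qed.

Lemma BD_mono P Q : prefix_of P Q -> BD P `<=` BD Q.
Proof.
move=> PQ C /BDP[R [X [P' [-> Rfin RX XP' [P'P P'fin]]]]]; apply/BDP.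
by exists R, X, P'; split=> //; split=> //; apply: prefix_of_trans P'P PQ.
Qed.

Lemma BD_iso P Q : isomorphic P Q -> BD P = BD Q.
Proof.
move=> PQ; apply/seteqP; split; apply: BD_mono; apply: preprefix_iso => //.
exact: isomorphic_sym.
Qed.

Lemma BD_self P Q : pfinite P -> prefix_of P Q -> BD Q (swap_class P).
Proof.
move=> Pfin PQ; apply/BDP; exists P, P, P; split=> //; first exact: prefix_of_refl.
exact: rt_refl.
Qed.

End SwapLift.

(** * Restricting a run to a causally closed set of indices *)

Section Restriction.
Variable N : net.

Notation letter := (option (trans N)).
Notation token := (option nat * eq_place N * nat)%type.
Implicit Types (L : nat -> letter) (c : token -> option nat) (D : pred nat).

Definition restr_lab D L j := if D j then L j else None.
Definition restr_cons D c x := if c x is Some j then if D j then Some j else None else None.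

Lemma restr_consE D c x j : restr_cons D c x = Some j <-> c x = Some j /\ D j.
Proof.
rewrite /restr_cons; case: (c x) => [i|]; last by split=> // -[].
case: ifP => Di; first by split=> [[<-] | []].
by split=> // -[[<-]]; rewrite Di.
Qed.

Definition closed_under c D := forall x j k, c x = Some j -> D j -> producer x = Some k -> D k.

Lemma restr_valid D L x : valid (restr_lab D L) x =
  valid L x && (if producer x is Some k then D k else true).
Proof.
rewrite /valid; case: (producer x) => [k|] /=; last by rewrite andbT.
by rewrite /restr_lab; case: ifP; rewrite ?andbT ?andbF.
Qed.

Lemma restr_run D L c : is_run L c -> closed_under c D ->
  is_run (restr_lab D L) (restr_cons D c).
Proof.
move=> [c1 c2] cD.
have mem x j : c x = Some j -> D j -> x \in tokens (restr_lab D L) j (label x).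
  move=> cx Dj; have := c1 _ _ cx; rewrite !mem_tokens restr_valid => /and3P[-> -> ->] /=.
  by case px: (producer x) => [k|] //; apply: cD cx Dj px.
split=> [x j /restr_consE[cx Dj] | j s]; first exact: mem.
rewrite /restr_lab; case: ifP => Dj; last first.
  apply/eqP; rewrite -leqn0 leqNgt -has_count; apply/hasPn => x _.
  by apply/eqP => /restr_consE[_]; rewrite Dj.
rewrite -c2; apply: eq_count_mem; rewrite ?tokens_uniq // => x.
apply/andP/andP => -[xt].
  move=> /eqP/restr_consE[cx _]; rewrite cx eqxx; split=> //.
  by move: xt; rewrite !mem_tokens restr_valid => /and3P[-> -> /andP[]].
move=> /eqP cx; split; last by apply/eqP/restr_consE.
by have := mem _ _ cx Dj; rewrite !mem_tokens in xt *; case/and3P: xt => /eqP ->.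
Qed.

Lemma restr_prefix D L c (cr : is_run L c) (cr' : is_run (restr_lab D L) (restr_cons D c)) :
  prefix_of (run_process cr') (run_process cr).
Proof.
have v (x : place (run_net (restr_lab D L) (restr_cons D c))) : valid L (val x).
  by have := valP x; rewrite restr_valid => /andP[].
have d (j : trans (run_net (restr_lab D L) (restr_cons D c))) : isSome (L (val j)) && D (val j).
  by have := valP j; rewrite /= /restr_lab; case: (D _) => //; rewrite andbT.
have d1 (j : trans (run_net (restr_lab D L) (restr_cons D c))) : isSome (L (val j)).
  by have /andP[] := d j.
exists (fun x => Sub (val x) (v x)), (fun j => Sub (val j) (d1 j)); split.
- by move=> x y [/val_inj].
- by move=> x y [/val_inj].
- split=> // s H; apply/eqP; rewrite /= eqb0; apply/eqP => ps.
  have sv : valid (restr_lab D L) (val s) by rewrite restr_valid (valP s) ps.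
  by apply: H; exists (Sub (val s) sv) => //; apply: val_inj.
- move=> s t /=; split=> //; congr (nat_of_bool _); have /andP[_ Dt] := d t.
  by apply/eqP/eqP => [cs|/restr_consE[]] //; apply/restr_consE.
- split=> // t; apply: Some_inj; rewrite -run_piT /=.
  have := @run_piT N _ (restr_cons D c) t => <-.
  by rewrite /restr_lab; have /andP[_ ->] := d t.
Qed.

Lemma restr_piT D L c (j : trans (run_net (restr_lab D L) c)) :
  D (val j) /\ L (val j) = Some (@piT N (run_preprocess (restr_lab D L) c) j).
Proof. by have := run_piT j; rewrite /restr_lab; case: ifP. Qed.

Lemma trunc_closed L c n : is_run L c -> closed_under c (fun j => j < n).
Proof. by move=> cr x j k cx jn xk; have [] := is_run_mem cr cx; rewrite xk /=; lia. Qed.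

Definition trunc_run L c n (cr : is_run L c) := restr_run cr (trunc_closed (n := n) cr).

Lemma bounded_pfinite L c (cr : is_run L c) n :
  (forall j, n <= j -> L j = None) -> pfinite (run_process cr).
Proof.
move=> Ln; apply: (@finite_set_seq _ _ (pmap insub (iota 0 n))) => j _.
rewrite mem_pmap_sub mem_iota /= ltnNge; apply/negP => /Ln E.
by have := valP j; rewrite E.
Qed.

Lemma trunc_lab_bounded L n j : n <= j -> restr_lab (fun j => j < n) L j = None.
Proof. by rewrite /restr_lab ltnNge => ->. Qed.

Lemma trunc_pfinite L c n (cr : is_run L c) : pfinite (run_process (trunc_run n cr)).
Proof. apply: bounded_pfinite (@trunc_lab_bounded L n). Qed.

Lemma finite_prefix_trunc L c (cr : is_run L c) (P : process N) :
  pfinite P -> prefix_of P (run_process cr) ->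
  exists n, prefix_of P (run_process (trunc_run n cr)).
Proof.
move=> Pfin [f [g fg]]; have [l lU lA] := finite_set_classic_seq Pfin.
pose n := (\sum_(t <- l) val (g t)).+1.
have gn t : val (g t) < n.
  by have /lA tl : [set: trans (pnet P)] t by []; rewrite ltnS (big_rem _ tl) leq_addr.
have [fI gI [fi fn] fa [fp gp]] := fg.
(* A place of the prefix is initial or produced by a transition of the prefix, so bounding the
   transitions also bounds the places. *)
have fv s : valid (restr_lab (fun j => j < n) L) (val (f s)).
  rewrite restr_valid (valP (f s)) /=; case fs: (producer _) => [k|] //.
  have Lk := run_producer (valP (f s)) fs.
  have [|u /(congr1 val) /= -> _] := @prefix_producer N P (run_process cr) f g fg (Sub k Lk) s.
    by rewrite /= fs eqxx.
  exact: gn.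
have gs t : isSome (restr_lab (fun j => j < n) L (val (g t))).
  by rewrite /restr_lab gn; apply: (valP (g t)).
exists n, (fun s => Sub (val (f s)) (fv s)), (fun t => Sub (val (g t)) (gs t)); split.
- by move=> x y [/val_inj/fI].
- by move=> x y [/val_inj/gI].
- split=> [s|s H]; first by rewrite -fi.
  have sv : valid L (val s) by have := valP s; rewrite restr_valid => /andP[].
  rewrite -[RHS](fn (Sub (val s) sv)) // => -[p _ pE]; apply: H; exists p => //.
  by apply: val_inj; rewrite /= pE.
- move=> s t /=; have [<- <-] := fa s t; split=> //=; congr (nat_of_bool _).
  by apply/eqP/eqP => [/restr_consE[]|cs] //; apply/restr_consE; split=> //; apply: gn.
- split=> [s|t]; first by rewrite -fp.
  rewrite -gp; apply: Some_inj; rewrite -[RHS](@run_piT N L c (g t)).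
  rewrite -[LHS](@run_piT N _ (restr_cons (fun j => j < n) c) (Sub (val (g t)) (gs t))).
  by rewrite /= /restr_lab gn.
Qed.

(** A finite prefix lies in a truncation, and truncations of two runs of [L] at the same index are
    swapping equivalent. *)
Lemma BD_lab_sub L c c' (Nc : countable_net N) (cr : is_run L c) (cr' : is_run L c') :
  BD (run_process cr) `<=` BD (run_process cr').
Proof.
move=> C /(BDP Nc)[R [Q [P' [-> Rfin RQ QP' [P'P P'fin]]]]]; apply/(BDP Nc).
have [n P'n] := finite_prefix_trunc P'fin P'P.
have [Q2 QQ2 Q2n] := swap_eq_prefix Nc QP' P'n.
exists R, Q2, (run_process (trunc_run n cr')); split=> //.
- exact: prefix_of_trans RQ QQ2.
- by apply: rt_trans Q2n _; apply: (run_swap_eq _ _ (@trunc_lab_bounded L n)).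
- by split; [exact: restr_prefix | exact: trunc_pfinite].
Qed.

Lemma BD_lab L c c' (Nc : countable_net N) (cr : is_run L c) (cr' : is_run L c') :
  BD (run_process cr) = BD (run_process cr').
Proof. by apply/seteqP; split; apply: BD_lab_sub. Qed.

End Restriction.

(** * Words of letters and concurrency *)

Section Words.
Variable N : net.
Notation letter := (option (trans N)).
Implicit Types (L : nat -> letter) (M : marking N) (w v : seq letter) (a b u : letter).

Definition can_fire M a := forall s, pre a s <= M s.

Fixpoint fires_word M w : Prop :=
  if w is a :: w' then can_fire M a /\ fires_word (step M a) w' else True.

Lemma fires_word_cat M w v :
  fires_word M (w ++ v) <-> fires_word M w /\ fires_word (foldl (@step N) M w) v.
Proof. by elim: w M => [|a w IH] M /=; [tauto | rewrite IH; tauto]. Qed.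

Lemma mark_foldl L n : mark L n = foldl (@step N) (@init N) (mkseq L n).
Proof.
by elim: n => // n IH; rewrite mkseqS foldl_rcons /= IH.
Qed.

Lemma firableP L : firable L <-> forall n, fires_word (@init N) (mkseq L n).
Proof.
split=> [H n | H j s].
  elim: n => // n IH; rewrite mkseqS -cats1 fires_word_cat; split=> //=; split=> // s.
  by rewrite -mark_foldl; apply: H.
have := H j.+1; rewrite mkseqS -cats1 fires_word_cat => -[_ [+ _]].
by rewrite -mark_foldl; apply.
Qed.

Definition append w L j := if j < size w then nth None w j else L (j - size w).

Lemma mkseq_append w L n : mkseq (append w L) (size w + n) = w ++ mkseq L n.
Proof.
rewrite /mkseq iotaD map_cat; congr (_ ++ _).
  rewrite -[RHS](mkseq_nth None) /mkseq; apply/eq_in_map => j.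
  by rewrite mem_iota /append => /= ->.
rewrite add0n -[in LHS](addn0 (size w)) iotaDl -map_comp; apply: eq_map => j /=.
by rewrite /append ltnNge leq_addr /= addKn.
Qed.

Lemma append_mkseq L n : append (mkseq L n) (fun j => L (n + j)) = L.
Proof.
apply/funext => j; rewrite /append size_mkseq; case: ltnP => jn; first by rewrite nth_mkseq.
by rewrite subnKC.
Qed.

Lemma append_cat w v L : append (w ++ v) L = append w (append v L).
Proof.
apply/funext => j; rewrite /append size_cat nth_cat; rewrite subnDA.
case: (ltnP j (size w)) => jw; first by rewrite (leq_trans jw (leq_addr _ _)).
by have -> : (j < size w + size v) = (j - size w < size v) by lia.
Qed.

Lemma append_firable w L n : firable (append w L) ->
  fires_word (@init N) (w ++ mkseq L n).
Proof. by move=> /firableP H; rewrite -mkseq_append. Qed.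

Lemma firable_append w L : (forall n, fires_word (@init N) (w ++ mkseq L n)) ->
  firable (append w L).
Proof.
move=> H; apply/firableP => n; have := H n; rewrite -mkseq_append.
have -> : mkseq (append w L) (size w + n) =
    mkseq (append w L) n ++ drop n (mkseq (append w L) (size w + n)).
  rewrite -[LHS](cat_take_drop n); congr (_ ++ _).
  by rewrite /mkseq -map_take take_iota; congr (map _ (iota _ _)); lia.
by rewrite fires_word_cat => -[].
Qed.

Definition skip : nat -> letter := fun=> None.

Lemma fires_word_skip M n : fires_word M (mkseq skip n).
Proof.
by elim: n M => // n IH M; rewrite mkseqS -cats1 fires_word_cat; split.
Qed.

Lemma msum_set1 (T : Type) (t : T) (f : T -> nat) : msum (mset_of [set t]) f = f t.
Proof.
rewrite (@msum_seq _ _ f [:: (t : {classic T})]) //.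
  by rewrite big_seq1 /mset_of mem_set // mul1n.
by move=> x; rewrite /mset_of lt0b => /set_mem ->; rewrite mem_head.
Qed.

Lemma fires_set1 M t : can_fire M (Some t) ->
  fires M (mset_of [set t]) (step M (Some t)).
Proof.
move=> Mt; split.
- apply: (@finite_set_seq {classic trans N} _ [:: (t : {classic trans N})]) => x.
  by rewrite /msupp /mset_of /= lt0b => /set_mem ->; rewrite mem_head.
- by exists t; rewrite /msupp /mset_of /= mem_set.
- by move=> s; rewrite /preG msum_set1; apply: Mt.
- by apply/funext => s; rewrite /madd /mdiff /preG /postG !msum_set1.
Qed.

Lemma foldl_step_reachable M w : reachable M -> fires_word M w ->
  reachable (foldl (@step N) M w).
Proof.
elim: w M => [|a w IH] M //= [sigma Ms] [Ma /IH]; apply.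
case: a Ma => [t|] Ma; last first.
  suff -> : step M None = M by exists sigma.
  by apply/funext => s; rewrite /step /= subn0 addn0.
exists (rcons sigma t); elim: sigma (@init N) Ms => [|v sigma IHs] M0 /=.
  by move=> ->; exists (step M (Some t)) => //; apply: fires_set1.
by move=> [M1 M01 /IHs]; exists M1.
Qed.

Definition concurrent M a b := forall s, pre a s + pre b s <= M s.

Lemma concurrentC M a b : concurrent M a b -> concurrent M b a.
Proof. by move=> H s; rewrite addnC. Qed.

Lemma stepC M a b : concurrent M a b -> step (step M a) b = step (step M b) a.
Proof. by move=> H; apply/funext => s; have := H s; rewrite /step; lia. Qed.

Lemma concurrent_fires M a b : concurrent M a b ->
  can_fire M a /\ can_fire (step M a) b.
Proof. by move=> H; split=> s; have := H s; rewrite /step; lia. Qed.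

(** Equal transitions must be excluded: restricting {t,t} to t gives {t,t} back, so such a multiset
    is never in conflict and the hypothesis on the net says nothing about it. *)
Lemma bcf_concurrent M a b : binary_conflict_free N -> reachable M ->
  can_fire M a -> can_fire M b -> (a = b -> a = None) -> concurrent M a b.
Proof.
move=> bcf Mr; case: a => [t|] Ma; last by move=> Mb _ s; rewrite add0n; apply: Mb.
case: b => [u|] Mb ab; last by move=> s; rewrite addn0; apply: Ma.
have {ab} tu : t <> u by move=> tu; have := ab (congr1 Some tu).
pose l := [:: (t : {classic trans N}); (u : {classic trans N})].
have lU : uniq l by rewrite /= mem_seq1 andbT; apply/eqP.
pose G := mset_of [set t; u].
have GE (x : {classic trans N}) : (x \in l) = (0 < G x).
  rewrite lt0b; apply/idP/idP.
    by rewrite in_cons mem_seq1 => /orP[] /eqP ->; apply: mem_set; [left|right].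
  by move/set_mem => [->|->]; rewrite !inE eqxx ?orbT.
have Gsum f : msum G f = f t + f u.
  rewrite (@msum_seq _ _ f l) //; last by move=> x; rewrite GE.
  have G1 x : x \in l -> G x = 1 by rewrite GE lt0b => xG; rewrite /G /mset_of xG.
  by rewrite !big_cons big_nil !G1 ?mul1n ?addn0 // !inE eqxx ?orbT.
have Gcard : mcard G 2.
  by apply/mcard_seq; [move=> x; apply: leq_b1 | exists l].
apply: contrapT => nc; apply: (bcf G Gcard M Mr); split.
- by case: Gcard.
- by exists t; rewrite /msupp /= -GE mem_head.
- move=> v Gv; have restrE : mrestr G [set v] = mset_of [set v].
    apply/funext => x; rewrite /mrestr /mset_of; case: ifP => //= /set_mem ->.
    by move: Gv; rewrite /msupp /G /mset_of /=; case: (v \in _).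
  have Mv : can_fire M (Some v).
    by move: Gv; rewrite /msupp /= lt0b => /set_mem[->|->].
  by rewrite restrE; exists (step M (Some v)); apply: fires_set1.
- move=> [M' [_ _ H _]]; apply: nc => s.
  by have := H s; rewrite /preG Gsum.
Qed.

(** One step of trace equivalence, with an independence relation that depends on the marking
    reached. *)
Definition word_swap w w' := exists v a b v',
  [/\ w = v ++ a :: b :: v', w' = v ++ b :: a :: v' &
      concurrent (foldl (@step N) (@init N) v) a b].

Definition word_eq := clos_refl_trans _ word_swap.

Local Notation enabled_word := (fires_word (@init N)).
Local Notation after := (foldl (@step N) (@init N)).

Lemma word_eq_catr w w' v : word_eq w w' -> word_eq (w ++ v) (w' ++ v).
Proof.
elim=> [x y [z [a [b [z' [-> -> H]]]]]|x|x y z _ xy _ yz].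
- by apply: rt_step; exists z, a, b, (z' ++ v); rewrite -!catA.
- exact: rt_refl.
- exact: rt_trans xy yz.
Qed.

Lemma word_eq_sym w w' : word_eq w w' -> word_eq w' w.
Proof.
elim=> [x y [z [a [b [z' [-> -> H]]]]]|x|x y z _ xy _ yz].
- by apply: rt_step; exists z, b, a, z'; split=> //; apply: concurrentC.
- exact: rt_refl.
- exact: rt_trans yz xy.
Qed.

Lemma word_eq_after w w' : word_eq w w' -> after w = after w'.
Proof.
elim=> [x y [z [a [b [z' [-> -> H]]]]]|x|x y z _ xy _ yz] //; last by rewrite xy.
by rewrite !foldl_cat /= stepC.
Qed.

Lemma word_eq_enabled w w' : word_eq w w' -> enabled_word w -> enabled_word w'.
Proof.
elim=> [x y [z [a [b [z' [-> -> H]]]]]|x|x y z _ xy _ yz] //; last by move/xy.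
rewrite !fires_word_cat /= (stepC H).
by have := concurrent_fires (concurrentC H); tauto.
Qed.

Hypothesis bcf : binary_conflict_free N.

Lemma init_reachable : reachable (@init N).
Proof. by exists [::]. Qed.

(** While [u] has not fired it is concurrent with each next letter, so it survives that letter and
    can finally be moved back over all of [v]. *)
Lemma commute w u v : enabled_word (w ++ v) -> enabled_word (w ++ [:: u]) ->
  (forall j, j < size v -> nth None v j = u -> u = None) ->
  enabled_word (w ++ v ++ [:: u]) /\ word_eq (w ++ v ++ [:: u]) (w ++ u :: v).
Proof.
elim: v w => [|a v IH] w wv wu H; first by split=> //; apply: rt_refl.
have [w_en [wa _]] := (fires_word_cat _ _ _).1 wv.
have [_ [wu1 _]] := (fires_word_cat _ _ _).1 wu.
have Hau : concurrent (after w) a u.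
  apply: bcf_concurrent => //.
    exact: foldl_step_reachable init_reachable w_en.
  by move=> au; rewrite au; apply: (H 0).
have [||j jv|wvu E] := IH (rcons w a).
- by rewrite cat_rcons.
- rewrite cat_rcons fires_word_cat /=; split=> //.
  by have [? ?] := concurrent_fires Hau.
- exact: (H j.+1).
rewrite cat_rcons in wvu E; split=> //; apply: rt_trans E _.
by rewrite cat_rcons; apply: rt_step; exists w, a, u, v.
Qed.

Lemma commute_concurrent w u v b :
  enabled_word (w ++ v) -> enabled_word (w ++ [:: u]) ->
  (forall j, j < size v -> nth None v j = u -> u = None) ->
  can_fire (after (w ++ v)) b -> (b = u -> b = None) -> concurrent (after (w ++ v)) b u.
Proof.
move=> wv wu H wb bu; apply: bcf_concurrent => //.
  exact: foldl_step_reachable init_reachable wv.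
have [+ _] := commute wv wu H; rewrite catA fires_word_cat /=; tauto.
Qed.

(** If [u] occurs in [v], its first occurrence is moved to the front; otherwise [u] is first added
    at the end. *)
Lemma move_front w u v : enabled_word (w ++ v) -> enabled_word (w ++ [:: u]) ->
  exists v' e, word_eq (w ++ u :: v') (w ++ v ++ e) /\ enabled_word (w ++ u :: v').
Proof.
move=> wv wu.
have [[j [jv ju ju0]]|H] := EM (exists j, [/\ j < size v, nth None v j = u & u <> None]).
  have [i [iv iu] min_i] : exists2 i, i < size v /\ nth None v i = u &
      forall k, k < i -> nth None v k <> u.
    have ex : exists i, `[< i < size v /\ nth None v i = u >] by exists j; apply/asboolP.
    case: (ex_minnP ex) => i /asboolP H Hmin; exists i => // k ki ku.
    have: i <= k by apply: Hmin; apply/asboolP; split=> //; case: H; lia.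
    lia.
  have vE : v = take i v ++ u :: drop i.+1 v.
    by rewrite -[RHS]/(_ ++ _) -iu -drop_nth // cat_take_drop.
  have wi : enabled_word (w ++ take i v).
    by move: wv; rewrite {1}vE catA fires_word_cat => -[].
  have [|wvu E] := commute wi wu.
    move=> k; rewrite size_take iv => ki; rewrite nth_take // => ku.
    by case: (min_i k ki).
  exists (take i v ++ drop i.+1 v), [::].
  have E' : word_eq (w ++ v ++ [::]) (w ++ u :: take i v ++ drop i.+1 v).
    have := word_eq_catr (drop i.+1 v) E.
    by rewrite -!catA /= cats0 {5}vE.
  split; first exact: word_eq_sym.
  by apply: word_eq_enabled E' _; rewrite cats0.
have [|wvu E] := commute wv wu.
  by move=> j jv ju; apply: contrapT => u0; apply: H; exists j.
by exists v, [:: u]; split; [exact: word_eq_sym | exact: word_eq_enabled E wvu].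
Qed.

(** The letters of [v] are moved one after the other to the front of [z], each being added at the
    end where it is missing. *)
Lemma word_join v w z : enabled_word (w ++ v) -> enabled_word (w ++ z) ->
  exists v' e, word_eq (w ++ v ++ v') (w ++ z ++ e) /\ enabled_word (w ++ z ++ e).
Proof.
elim: v w z => [|u v IH] w z wv wz.
  by exists z, [::]; rewrite cats0; split=> //; apply: rt_refl.
have wu : enabled_word (w ++ [:: u]).
  by move: wv; rewrite -cat1s catA fires_word_cat => -[].
have [z' [e [E wuz]]] := move_front wz wu.
have [||v' [e' [E' en]]] := IH (rcons w u) z'; rewrite ?cat_rcons //.
rewrite !cat_rcons in E' en.
exists v', (e ++ e').
have E2 : word_eq (w ++ u :: z' ++ e') (w ++ z ++ e ++ e').
  by have := word_eq_catr e' E; rewrite -!catA.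
split; last exact: word_eq_enabled E2 en.
exact: rt_trans E' E2.
Qed.

End Words.

(** * BD of a sequence *)

Section BDLab.
Variable N : net.
Hypothesis Nc : countable_net N.
Notation letter := (option (trans N)).
Notation token := (option nat * eq_place N * nat)%type.
Implicit Types (L : nat -> letter) (c : token -> option nat) (w v : seq letter).
Local Notation enabled_word := (fires_word (@init N)).
Local Notation after := (foldl (@step N) (@init N)).

(** All runs of [L] contribute the same set, so the union avoids choosing one; it is empty if [L] is
    not firable. *)
Definition BDL L : set (set (process N)) :=
  [set C | exists c (cr : is_run L c), BD (run_process cr) C].

Lemma BDL_run L c (cr : is_run L c) : BD (run_process cr) = BDL L.
Proof.
apply/seteqP; split=> C; first by exists c, cr.
by move=> [c' [cr']]; rewrite (BD_lab Nc cr' cr).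
Qed.

Lemma process_run (P : process N) : exists L c (cr : is_run L c),
  isomorphic P (run_process cr).
Proof.
have [g gl] := linearization_exists P Nc.
have [L [c [cr [f [h [fh _]]]]]] := linearization_run gl.
by exists L, c, cr, f, h.
Qed.

Lemma process_firable (P : process N) : exists2 L, firable L & BD P = BDL L.
Proof.
have [L [c [cr iso]]] := process_run P; exists L; first exact: run_firable cr.
by rewrite -(BDL_run cr); apply: BD_iso.
Qed.

(** Renumbering so that producers stay before consumers is just another linearization of the same
    process. *)
Lemma run_reindex L c (cr : is_run L c) (r : nat -> nat) : injective r ->
  (forall x i j, c x = Some j -> producer x = Some i -> r i < r j) ->
  exists2 L', BDL L' = BDL L &
    firable L' /\ forall i a, L' i = Some a <-> exists2 j, r j = i & L j = Some a.
Proof.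
move=> rI rM.
have gl : linearization (P := run_process cr) (fun t => r (val t)).
  split=> [t u /rI/val_inj // | t s u /=].
  by rewrite !lt0b => /eqP ps /eqP cs; apply: rM cs ps.
have [L' [c' [cr' [f [h [fh hg]]]]]] := linearization_run gl.
exists L'; last split.
- rewrite -(BDL_run cr) -(BDL_run cr'); apply: BD_iso => //; apply: isomorphic_sym.
  by exists f, h.
- exact: run_firable cr'.
have [_ [h' hK h'K] _ _ [_ hp]] := fh.
have labE (t : trans (pnet (run_process cr))) : L' (r (val t)) = L (val t).
  by have /= <- := hg t; rewrite (@run_piT N L' c' (h t)) (@run_piT N L c t) hp.
move=> i a; split=> [L'i | [j <- Lj]].
  have Li : isSome (L' i) by rewrite L'i.
  have iE : r (val (h' (Sub i Li))) = i by have /= <- := hg (h' (Sub i Li)); rewrite h'K.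
  by exists (val (h' (Sub i Li))); rewrite // -labE iE.
have Lj' : isSome (L j) by rewrite Lj.
by rewrite (labE (Sub j Lj')).
Qed.

Lemma option_ext (T : Type) (o o' : option T) :
  (forall x, o = Some x <-> o' = Some x) -> o = o'.
Proof.
case: o => [x|] H; first by apply/esym/H.
by case: o' H => [y|] // /(_ y) [_]; apply.
Qed.

Lemma BDL_word_swap w w' L : word_swap w w' -> firable (append w L) ->
  BDL (append w L) = BDL (append w' L).
Proof.
move=> [v [a [b [v' [-> -> ab]]]]].
have E x y : v ++ x :: y :: v' = (v ++ [:: x; y]) ++ v' by rewrite -catA.
rewrite !E !append_cat {E}; set R := append v' L; set k := size v => wf.
have at_k x y : append v (append [:: x; y] R) k = x.
  by rewrite /append ltnn subnn.
have at_k1 x y : append v (append [:: x; y] R) k.+1 = y.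
  by rewrite /append ltnNge leqnSn /= subSnn.
have off_k x y x' y' j : j <> k -> j <> k.+1 ->
    append v (append [:: x; y] R) j = append v (append [:: x'; y'] R) j.
  move=> jk jk1; rewrite /append -/k; case: ltnP => // kj /=.
  by have -> : (j - k < 2) = false by lia.
have mark_k : mark (append v (append [:: a; b] R)) k = after v.
  by rewrite mark_foldl -[k]addn0 mkseq_append /mkseq cats0.
(* By concurrency the letter at [k.+1] can do without the tokens made at [k]; in such a run,
   exchanging the two indices respects causality. *)
have [|c cr cav] := @run_avoiding N _ k (fun j => j == k.+1) wf.
  move=> j s _ /eqP -> /=; rewrite /step at_k at_k1.
  by have := ab s; rewrite -mark_k; lia.
have [|x i j cx xi|L' <- [_ L'P]] := @run_reindex _ c cr (transpose k k.+1).
- exact: inv_inj (transposeK _ _).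
- have [ij _] := is_run_mem cr cx; rewrite xi /= in ij.
  have jk : j = k.+1 -> i <> k.
    by move=> jk ik; have := cav _ _ cx; rewrite jk eqxx xi ik eqxx => /(_ isT).
  rewrite /transpose; do ! case: asboolP => ?; lia.
congr BDL; apply/funext => i; apply: option_ext => x; rewrite L'P.
have E j : append v (append [:: b; a] R) (transpose k k.+1 j) = append v (append [:: a; b] R) j.
  apply: (transposeP (Q := fun j j' => append v (append [:: b; a] R) j' =
                           append v (append [:: a; b] R) j)).
  - by rewrite at_k at_k1.
  - by rewrite at_k at_k1.
  - by move=> jk jk1; apply: off_k.
split=> [[j <- <-] | H]; first exact: E.
by exists (transpose k k.+1 i); rewrite ?transposeK // -E transposeK.
Qed.

Lemma BDL_word_eq w w' L : word_eq w w' -> firable (append w L) ->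
  firable (append w' L) /\ BDL (append w L) = BDL (append w' L).
Proof.
move=> E wf; have w'f v v' : word_eq v v' -> firable (append v L) -> firable (append v' L).
  move=> vv' vf; apply: firable_append => n.
  by apply: word_eq_enabled (word_eq_catr _ vv') _; apply: append_firable.
split; first exact: w'f E wf.
elim: E wf => [x y xy|x|x y z xy IH1 yz IH2] wf //; first exact: BDL_word_swap.
by rewrite IH1 // IH2 //; apply: w'f xy wf.
Qed.

Lemma BDL_prefix L n : firable L -> BDL (append (mkseq L n) (skip N)) `<=` BDL L.
Proof.
move=> Lf; have [c cr] := run_exists Lf; rewrite -(BDL_run cr).
have -> : append (mkseq L n) (skip N) = restr_lab (fun j => j < n) L.
  apply/funext => j; rewrite /append /restr_lab size_mkseq.
  by case: ltnP => // jn; rewrite nth_mkseq.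
rewrite -(BDL_run (trunc_run n cr)).
exact: (BD_mono Nc (restr_prefix _ _)).
Qed.

Lemma firable_skip w : enabled_word w -> firable (append w (skip N)).
Proof.
move=> wf; apply: firable_append => n; rewrite fires_word_cat; split=> //.
exact: fires_word_skip.
Qed.

Lemma finite_class_word (P : process N) : pfinite P ->
  exists2 w, enabled_word w & BDL (append w (skip N)) (swap_class P).
Proof.
move=> Pfin; have [L [c [cr [f [h fh]]]]] := process_run P.
have [l _ lA] := finite_set_classic_seq Pfin.
pose n := (\sum_(t <- l) val (h t)).+1.
have Ln j : n <= j -> L j = None.
  move=> nj; case Lj: (L j) => [a|] //; have Lj' : isSome (L j) by rewrite Lj.
  have [_ [h' _ h'K] _ _ _] := fh.
  have /lA tl : [set: trans (pnet P)] (h' (Sub j Lj')) by [].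
  have : val (h (h' (Sub j Lj'))) < n by rewrite ltnS (big_rem _ tl) leq_addr.
  by rewrite h'K /=; lia.
exists (mkseq L n); first by have /firableP := run_firable cr; apply.
have -> : append (mkseq L n) (skip N) = L.
  rewrite -[RHS](append_mkseq L n); congr append; apply/funext => j.
  by rewrite Ln // leq_addr.
rewrite -(BDL_run cr); apply: BD_self => //.
by apply: preprefix_iso; exists f, h.
Qed.

Hypothesis bcf : binary_conflict_free N.

Lemma universal_lab : exists2 L, firable L &
  forall w, enabled_word w -> BDL (append w (skip N)) `<=` BDL L.
Proof.
have [e eI] := countable_injP _ Nc.2.
pose code w := pickle [seq omap e a | a <- w].
have codeI : injective code.
  move=> w w' /(pcan_inj pickleK); apply: inj_map => -[x|] [y|] //= [] /eI E.
  by congr Some; apply: E; rewrite inE.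
have /boolp.choice[en enP] : forall n, exists w, forall w', code w' = n -> w = w'.
  move=> n; have [[w <-]|H] := EM (exists w, code w = n); first by exists w => w' /codeI.
  by exists [::] => w' E; case: H; exists w'.
(* [ext (z, w)] extends [z] so that, up to exchanges, it begins with [w]. *)
have /boolp.choice[ext extP] : forall zw : seq letter * seq letter, exists x,
    enabled_word zw.1 -> enabled_word (zw.1 ++ x) /\
      (enabled_word zw.2 -> exists v', word_eq (zw.2 ++ v') (zw.1 ++ x)).
  move=> [z w] /=; have [[zf wf]|H] := EM (enabled_word z /\ enabled_word w).
    have [v' [x [E zx]]] := word_join bcf (w := [::]) wf zf.
    by exists x => _; split=> // _; exists v'.
  by exists [::] => zf; rewrite cats0; split=> // wf; case: H.
(* The final idle letter forces the lengths to grow, so that the chain has a limit defined at every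
   index. *)
pose tau := fix tau n := if n is n'.+1 then (tau n' ++ ext (tau n', en n')) ++ [:: None] else [::].
have tau_f n : enabled_word (tau n).
  elim: n => // n IH; rewrite [tau n.+1]/= fires_word_cat.
  by split; [case: (extP (tau n, en n) IH) | split].
have tau_size n : n <= size (tau n).
  by elim: n => // n IH; rewrite [tau n.+1]/= !size_cat /=; lia.
have tau_le m n : m <= n -> exists x, tau n = tau m ++ x.
  move=> /subnK <-; elim: (n - m) => [|k [x IH]]; first by exists [::]; rewrite cats0.
  by rewrite addSn [tau _.+1]/= {1}IH -!catA; eexists.
pose L j := nth None (tau j.+1) j.
have LE n j : j < size (tau n) -> nth None (tau n) j = L j.
  move=> jn; rewrite /L; have [/tau_le[x ->]|/ltnW/tau_le[x ->]] := leqP n j.+1.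
    by rewrite nth_cat jn.
  by rewrite nth_cat tau_size.
have Ltau n k : k <= size (tau n) -> mkseq L k = take k (tau n).
  move=> kn; apply: (@eq_from_nth _ None); first by rewrite size_mkseq size_takel.
  move=> j; rewrite size_mkseq => jk; rewrite nth_mkseq // nth_take //.
  by rewrite LE // (leq_trans jk).
have Lf : firable L.
  apply/firableP => n; rewrite (Ltau n) //.
  by have := tau_f n; rewrite -{1}(cat_take_drop n (tau n)) fires_word_cat => -[].
exists L => // w wf.
pose n := code w; have enw : en n = w by apply: enP.
have := extP (tau n, en n) (tau_f n); rewrite /= enw => -[en_f /(_ wf)[v' E]].
have full : mkseq L (size (tau n ++ ext (tau n, w))) = tau n ++ ext (tau n, w).
  have tauS : tau n.+1 = (tau n ++ ext (tau n, w)) ++ [:: None] by rewrite [LHS]/= enw.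
  by rewrite (Ltau n.+1) tauS ?take_size_cat // [leqRHS]size_cat leq_addr.
have E' := word_eq_sym E; have E2 := word_eq_enabled E' en_f.
(* The word [w] begins [w ++ v'], which is equivalent to a finite beginning of [L]. *)
apply: subset_trans (@BDL_prefix L (size (tau n ++ ext (tau n, w))) Lf).
rewrite full -(BDL_word_eq E (firable_skip E2)).2.
have := @BDL_prefix (append (w ++ v') (skip N)) (size w) (firable_skip E2).
by rewrite append_cat -{1}[size w]addn0 mkseq_append /mkseq cats0.
Qed.

End BDLab.

(** * Maximal processes *)

Section TransitionCount.
Variable N : net.
Implicit Types P Q R : process N.

(** The invariant that bounds BD: no class in BD of a process has more occurrences of a transition
    than the process itself. *)
Definition label_embeds (P Q : preprocess N) :=
  exists g : trans (pnet P) -> trans (pnet Q), injective g /\ forall t, piT (g t) = piT t.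

Lemma label_embeds_trans (P Q R : preprocess N) :
  label_embeds P Q -> label_embeds Q R -> label_embeds P R.
Proof.
move=> [g [gI gp]] [h [hI hp]]; exists (h \o g); split; first exact: inj_comp.
by move=> t; rewrite /= hp gp.
Qed.

Lemma prefix_label_embeds P Q : prefix_of P Q -> label_embeds P Q.
Proof. by move=> [f [g [_ gI _ _ [_ gp]]]]; exists g. Qed.

Lemma swap_eq_label_embeds P Q : swap_eq P Q -> label_embeds P Q.
Proof.
elim=> [R S [p [q [_ _ _ [f [g [_ gb _ _ [_ gp]]]]]]]|R|R S T _ RS _ ST].
- by exists g; split=> //; apply: bij_inj gb.
- by exists id; split.
- exact: label_embeds_trans RS ST.
Qed.

Lemma BD_label_embeds P R : countable_net N -> BD P (swap_class R) -> label_embeds R P.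
Proof.
move=> Nc /(BDP Nc)[R1 [Q [P' [E _ R1Q QP' [P'P _]]]]].
have : swap_class R R by apply: rt_refl.
rewrite E => /swap_eq_label_embeds RR1.
apply: label_embeds_trans RR1 _; apply: label_embeds_trans (prefix_label_embeds R1Q) _.
exact: label_embeds_trans (swap_eq_label_embeds QP') (prefix_label_embeds P'P).
Qed.

End TransitionCount.

(** * A maximal process absorbs every firable word *)

Section Maximal.
Variable N : net.
Hypothesis Nc : countable_net N.
Hypothesis bcf : binary_conflict_free N.
Notation letter := (option (trans N)).
Implicit Types (L : nat -> letter) (w v : seq letter).
Local Notation enabled_word := (fires_word (@init N)).
Local Notation after := (foldl (@step N) (@init N)).

Lemma BDL_insert_skip w L : firable (append w L) ->
  BDL (append (rcons w None) L) = BDL (append w L).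
Proof.
move=> wf; have [c cr] := run_exists wf.
have bumpI : injective (bump (size w)) by apply: can_inj (bumpK _).
have [|L' <- [_ L'P]] := run_reindex Nc cr bumpI.
  move=> x i j cx xi; have [+ _] := is_run_mem cr cx.
  by rewrite xi /= /bump; lia.
congr BDL; apply/funext => k; apply: option_ext => a; rewrite L'P.
have E j : append (rcons w None) L (bump (size w) j) = append w L j.
  rewrite /append /bump size_rcons nth_rcons; case: (leqP (size w) j) => wj.
    have -> : (1 + j < (size w).+1) = false by lia.
    by congr L; lia.
  by rewrite add0n wj ltnS ltnW.
split=> [kE | [j <- <-] //].
have [kw|kw] := eqVneq k (size w).
  by move: kE; rewrite kw /append size_rcons ltnSn nth_rcons ltnn eqxx.
by exists (unbump (size w) k); rewrite ?unbumpK // -E unbumpK.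
Qed.

Lemma mkseq_append_size w L : mkseq (append w L) (size w) = w.
Proof. by rewrite -[in LHS](addn0 (size w)) mkseq_append /mkseq cats0. Qed.

Variable P : process N.
Hypothesis P_max : forall P' Q : process N,
  BD P = BD P' -> prefix_of P' Q -> BD P' = BD Q.

(** If [t] never occurred, it could be inserted after [w] so that no letter consumes its products.
    Deleting it again gives a process equivalent to [P] with a proper extension, and maximality
    fails by counting occurrences of [t]. *)
Lemma letter_occurs w L t : firable (append w L) -> BDL (append w L) = BD P ->
  enabled_word (rcons w (Some t)) -> exists n, L n = Some t.
Proof.
move=> wf BDE wt; apply: contrapT => H.
have never n : L n <> Some t by move=> Ln; apply: H; exists n.
pose i := size w; pose u := Some t.
rewrite -cats1 in wt.
have nth_never n j : j < size (mkseq L n) -> nth None (mkseq L n) j = u -> u = None.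
  by rewrite size_mkseq => jn; rewrite nth_mkseq // => /never.
have comm n := commute bcf (append_firable n wf) wt (@nth_never n).
pose Lu := append (rcons w u) L.
have Luf : firable Lu.
  apply: firable_append => n; rewrite cat_rcons.
  by have [en E] := comm n; apply: word_eq_enabled E en.
have Lu_i : Lu i = u by rewrite /Lu /append size_rcons ltnSn nth_rcons ltnn eqxx.
have Lu_gt n : Lu (i.+1 + n) = L n.
  by rewrite /Lu /append size_rcons ltnNge leq_addr addKn.
have [|c cr cav] := @run_avoiding N Lu i xpredT Luf.
  move=> j s ij _; have [n ->] : exists n, j = i.+1 + n by exists (j - i.+1); lia.
  (* The marking is computed as if [u] fired last, which is legitimate because [u] commutes with the
     letters of [L]. *)
  have -> : mark Lu (i.+1 + n) = step (after (w ++ mkseq L n)) u.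
    have <- : after (w ++ mkseq L n ++ [:: u]) = step (after (w ++ mkseq L n)) u.
      by rewrite catA foldl_cat.
    rewrite (word_eq_after (comm n).2) -cat_rcons -mkseq_append size_rcons.
    by rewrite mark_foldl.
  rewrite Lu_gt Lu_i.
  have Ln : can_fire (after (w ++ mkseq L n)) (L n).
    have := append_firable n.+1 wf; rewrite mkseqS -cats1 catA fires_word_cat.
    by move=> [_ []].
  (* Concurrency of [L n] and [u] means that the tokens needed by [L n] remain even when all
     products of [u] are set aside. *)
  have := commute_concurrent bcf (append_firable n wf) wt (@nth_never n) Ln.
  move=> /(_ (fun E => False_ind _ (never n E))) /(_ s).
  by move: (after _) => M; rewrite /step -/u; lia.
have closed : closed_under c (predC1 i).
  move=> x j k cx _ xk; rewrite /= -(inj_eq Some_inj) -xk.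
  exact: cav cx isT.
pose cr0 := restr_run cr closed.
have L0E : restr_lab (predC1 i) Lu = append (rcons w None) L.
  apply/funext => j; rewrite /restr_lab /Lu /append !size_rcons !nth_rcons /=.
  by case: (ltngtP j i) => [ji|ji|->]; rewrite ?ltnSn ?eqxx ?ltnn //.
have BD0 : BD P = BD (run_process cr0).
  by rewrite (BDL_run Nc) L0E BDL_insert_skip.
(* Maximality puts the class of the part up to and including [i] into BD of the run without [i]. *)
have := BD_self Nc (trunc_pfinite i.+1 cr) (restr_prefix cr (trunc_run i.+1 cr)).
rewrite -(P_max BD0 (restr_prefix cr cr0)) => /(BD_label_embeds Nc)[g [gI gp]].
(* That part has one more [u] than there are before [i], while the run without [i] has only those
   before [i]. *)
pose p j := `[< Lu j = u >].
pose l : seq (trans (pnet (run_process (trunc_run i.+1 cr)))) :=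
  pmap insub (filter p (iota 0 i.+1)).
have sl : size l = (count p (iota 0 i)).+1.
  have -> : size l = count p (iota 0 i.+1).
    rewrite size_pmap_sub -[RHS]size_filter; apply/eqP; rewrite -all_count; apply/allP => j.
    rewrite mem_filter mem_iota add0n /= /restr_lab => /andP[/asboolP pj ->].
    by rewrite pj.
  have pi : p i by apply/asboolP.
  by rewrite -[i.+1]addn1 iotaD count_cat add0n /= pi addn0 addn1.
have lB : size l <= size (filter p (iota 0 i)).
  rewrite -(size_map (val \o g)); apply: uniq_leq_size.
    rewrite map_inj_uniq; last by apply: inj_comp gI; apply: val_inj.
    by apply: pmap_sub_uniq; rewrite filter_uniq ?iota_uniq.
  move=> k /mapP[j]; rewrite mem_pmap_sub mem_filter => /andP[/asboolP ju _] ->.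
  have [_ jt] := @restr_piT _ _ _ (restr_cons (fun j => j < i.+1) c) j.
  have [gi gt] := @restr_piT _ _ _ (restr_cons (predC1 i) c) (g j).
  have gu : Lu (val (g j)) = u by rewrite gt -ju jt -gp.
  rewrite mem_filter mem_iota /= -[sval _]/(val (g j)); apply/andP; split; first exact/asboolP.
  rewrite ltnNge; apply/negP => ig; apply: (never (val (g j) - i.+1)).
  rewrite -Lu_gt subnKC // ltn_neqAle ig andbT eq_sym; exact: gi.
by move: lB; rewrite sl size_filter ltnn.
Qed.

(** The first occurrence of [u] in [L] is moved to the front. It exists unless [u] is idle, and then
    an idle step can be inserted. *)
Lemma letter_next w L u : firable (append w L) -> BDL (append w L) = BD P ->
  enabled_word (rcons w u) ->
  exists2 L', firable (append (rcons w u) L') & BDL (append (rcons w u) L') = BD P.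
Proof.
move=> wf BDE wu.
have [ex | H] := EM (exists n, `[< L n = u >]); last first.
  have uN : u = None.
    case: u wu H => // t wt; have [n Ln] := letter_occurs wf BDE wt.
    by case; exists n; apply/asboolP.
  exists L; last by rewrite uN BDL_insert_skip.
  rewrite uN; apply: firable_append => n; have := append_firable n wf.
  rewrite cat_rcons !fires_word_cat => -[? ?]; split=> //; split=> //.
  suff -> : step (after w) None = after w by [].
  by apply/funext => s; rewrite /step /= subn0 addn0.
case: (ex_minnP ex) => n /asboolP Ln n_min.
have [||_ E] := commute bcf (append_firable n wf) (u := u).
- by rewrite cats1.
- move=> j; rewrite size_mkseq => jn; rewrite nth_mkseq // => ju.
  by have := n_min j (introT (asboolP _) ju); rewrite leqNgt jn.
pose R j := L (n.+1 + j).
have LE : append w L = append (w ++ mkseq L n ++ [:: u]) R.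
  by rewrite append_cat cats1 -Ln -mkseqS append_mkseq.
have [|wf' BDE'] := BDL_word_eq Nc (L := R) E; first by rewrite -LE.
by exists (append (mkseq L n) R); rewrite -append_cat cat_rcons // -BDE' -LE.
Qed.

Lemma maximal_prefix w : enabled_word w ->
  exists2 L, firable (append w L) & BDL (append w L) = BD P.
Proof.
elim/last_ind: w => [_|w u IH wu].
  have [L Lf PE] := process_firable Nc P; exists L;
    by rewrite /append /= (funext (fun j => congr1 L (subn0 j))).
have [|L wf BDE] := IH; first by move: wu; rewrite -cats1 fires_word_cat => -[].
exact: letter_next wf BDE wu.
Qed.

Lemma maximal_BD w : enabled_word w -> BDL (append w (skip N)) `<=` BD P.
Proof.
move=> /maximal_prefix[L wf <-].
by have := BDL_prefix Nc (n := size w) wf; rewrite mkseq_append_size.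
Qed.

End Maximal.

(** * Existence and uniqueness *)

Theorem theorem4 (N : net) (N_countable : countable_net N)
    (N_bcf : binary_conflict_free N) :
  exists! C : set (process N), BD_process C /\ BD_maximal C.
Proof.
(* The classes of all finite processes form the largest possible BD. It is attained by the universal
   sequence and by every maximal process, hence uniqueness. *)
have full (P : process N) :
    (forall w, fires_word (@init N) w -> BDL (append w (skip N)) `<=` BD P) ->
    BD P = @finite_class N.
  move=> H; apply/seteqP; split=> C; first by case.
  by move=> [R Rfin ->]; have [w wf /(H _ wf)] := finite_class_word N_countable Rfin.
have [L Lf /= LP] := universal_lab N_countable N_bcf.
have [c cr] := run_exists Lf.
have Pfull : BD (run_process cr) = @finite_class N.
  by apply: full => w; rewrite (BDL_run N_countable); apply: LP.
exists (BD_class (run_process cr)); split; first split.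
- by exists (run_process cr).
(* Prefixes only enlarge BD, and here it is already as large as possible. *)
- move=> P' Q PP' P'Q; rewrite /swap_eq_inf -PP' Pfull; apply/seteqP; split=> C.
    by rewrite -Pfull PP'; apply: BD_mono.
  by case.
move=> C [[P ->] Pmax]; have Pf : BD P = @finite_class N.
  by apply: full; apply: maximal_BD.
by apply/seteqP; split=> Q; rewrite /BD_class /= /swap_eq_inf Pf Pfull //.
Qed.
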